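(* For the Gibbs distributions of random tree $k$-SAT formulas described in the context, $$\alpha_{\rm u}(k)=\frac{2\log k}{k}\left\{1+O\!\left(\frac{\log\log k}{\log k}\right)\right\},\qquad \alpha_{\rm u}'(k)=\frac{2\log k}{k}\left\{1+O\!\left(\frac{\log\log k}{\log k}\right)\right\}$$ as $k\to\infty$.
   Context: Fix $k\ge 2$, $\alpha>0$. The random tree formula ${\sf T}_*(r)$ is defined recursively: ${\sf T}_*(0)$ consists of a single variable node (the root, denoted $0$). For $r\ge1$, start with a root variable, add $l\sim{\sf Poisson}(k\alpha)$ clauses, each containing the root and $k-1$ new variables (first-generation variables), each literal in each clause being negated or not independently with probability $1/2$; if $r\ge2$, attach to each first-generation variable an independent copy of ${\sf T}_*(r-1)$ rooted at it. The variables at distance $r$ from the root form the $r$-th generation. For a formula with clauses $C_j$ and $\beta\in[0,\infty]$, the Gibbs distribution is $\mu(\underline{x})\propto\prod_j\psi_j(\underline{x})$ with $\psi_j(\underline{x})=1$ if $\underline{x}$ satisfies $C_j$ and $e^{-\beta}$ otherwise, i.e. $\mu(\underline{x})\propto e^{-\beta E(\underline{x})}$ where $E(\underline{x})$ is the number of unsatisfied clauses (for $\beta=\infty$, the uniform measure on satisfying assignments). For the tree formula ${\sf T}_*(r)$, let $\mu_{0|r}(\cdot|\underline{x}_r)$ be the conditional distribution of the root variable given the assignment $\underline{x}_r$ of the $r$-th generation variables (for $\beta=\infty$, only boundary assignments $\underline{x}_r$ compatible with at least one satisfying assignment are considered). The Gibbs distribution is said to be unique with exponential correlation decay (for given $\alpha,\beta,k$)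 if there exist $A,\gamma>0$ with $\mathbb{E}\big[\sup_{\underline{x}_r,\underline{z}_r}\|\mu_{0|r}(\cdot|\underline{x}_r)-\mu_{0|r}(\cdot|\underline{z}_r)\|_{\rm TV}\big]\le A e^{-\gamma r}$ for all $r\ge0$, the expectation being over the random tree. $\alpha_{\rm u}(k)$ is the supremum of $\alpha$ such that this holds for every $\beta\in[0,\infty]$. $\alpha'_{\rm u}(k)$ is the supremum of $\alpha$ such that, for every $\beta\in[0,\infty]$, $\sup_{\underline{x}_r,\underline{z}_r}\|\mu_{0|r}(\cdot|\underline{x}_r)-\mu_{0|r}(\cdot|\underline{z}_r)\|_{\rm TV}\to0$ almost surely as $r\to\infty$ (for the infinite tree ${\sf T}_*(\infty)$, whose first $r$ generations are distributed as ${\sf T}_*(r)$). *)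

(* Defs.v *)
From HB Require Import structures.
From mathcomp Require Import all_boot all_order all_algebra.
From mathcomp Require Import all_classical all_reals all_analysis.
Set Implicit Arguments.
Unset Strict Implicit.
Unset Printing Implicit Defensive.
Import Order.TTheory GRing.Theory Num.Theory.
Import numFieldNormedType.Exports.
Local Open Scope classical_set_scope.
Local Open Scope ring_scope.

(* The literal (v, s) is satisfied by x when x v = s, so s = false is a negated
   occurrence of v. *)
Definition clause (V : finType) := seq (V * bool).
Definition formula (V : finType) := seq (clause V).

Section Gibbs.
Variables (R : realType) (V : finType).
Implicit Types (b : \bar R) (F : formula V) (x y : {ffun V -> bool}).

Definition sat_clause x (C : clause V) : bool := has (fun l => x l.1 == l.2) C.

Definition sat_formula x F : bool := all (sat_clause x) F.

(* expeR (- +oo) = 0: at b = +oo the weight is the indicator of the satisfying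
   assignments. *)
Definition psi b x (C : clause V) : R :=
  if sat_clause x C then 1 else fine (expeR (- b)).

Definition weight b F x : R := \prod_(C <- F) psi b x C.

Definition gibbs b F x : R := weight b F x / \sum_y weight b F y.

Variable B : pred V.
Implicit Types xB zB : {ffun {v : V | B v} -> bool}.

Definition agree y xB : bool := [forall v : {v : V | B v}, y (val v) == xB v].

Definition gibbs_cond b F xB (v : V) (s : bool) : R :=
  (\sum_(y | agree y xB && (y v == s)) gibbs b F y) /
  (\sum_(y | agree y xB) gibbs b F y).

Definition admissible b F xB : bool :=
  (b == +oo%E) ==> [exists y, agree y xB && sat_formula y F].

Definition tv_dist (p q : bool -> R) : R := 2^-1 * \sum_(s : bool) `|p s - q s|.

(* The supremum ranges over finitely many nonnegative reals. *)
Definition boundary_influence b F (v : V) : R :=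
  \big[Order.max/0]_(xz : {ffun {v : V | B v} -> bool} *
                          {ffun {v : V | B v} -> bool}
                     | admissible b F xz.1 && admissible b F xz.2)
    tv_dist (gibbs_cond b F xz.1 v) (gibbs_cond b F xz.2 v).

End Gibbs.

(* Tree formulas with r generations.  A clause at the root is given by the sign
   of the root in it and, for each of its k - 1 new variables, the sign of that
   variable and the tree formula hanging from it. *)
Fixpoint ftree (k r : nat) : countType :=
  if r is r'.+1 then seq (bool * {ffun 'I_k.-1 -> bool * ftree k r'})%type
  else unit.

Definition root_clauses (k r : nat) (t : ftree k r.+1) :
  seq (bool * {ffun 'I_k.-1 -> bool * ftree k r}) := t.

Definition clause_pos (k r : nat) (t : ftree k r.+1) : finType :=
  ('I_(size (root_clauses t)) * 'I_k.-1)%type.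

Definition root_clause (k r : nat) (t : ftree k r.+1)
    (j : 'I_(size (root_clauses t))) : bool * {ffun 'I_k.-1 -> bool * ftree k r} :=
  tnth (in_tuple (root_clauses t)) j.

Definition subtree (k r : nat) (t : ftree k r.+1) (ji : clause_pos t) :
  ftree k r := ((root_clause ji.1).2 ji.2).2.

Fixpoint tvar (k r : nat) : ftree k r -> finType :=
  match r return ftree k r -> finType with
  | 0 => fun _ => unit
  | r'.+1 => fun t => option {ji : clause_pos t & tvar (subtree ji)}
  end.

Definition troot (k r : nat) : forall t : ftree k r, tvar t :=
  match r return forall t : ftree k r, tvar t with
  | 0 => fun _ => tt
  | r'.+1 => fun t => None
  end.

(* The variables at distance r from the root. *)
Fixpoint last_gen (k r : nat) : forall t : ftree k r, pred (tvar t) :=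
  match r return forall t : ftree k r, pred (tvar t) with
  | 0 => fun _ _ => true
  | r'.+1 => fun t v => if v is Some (existT ji w) then last_gen w else false
  end.

Definition lift_var (k r : nat) (t : ftree k r.+1) (ji : clause_pos t)
  (w : tvar (subtree ji)) : tvar t := Some (existT _ ji w).

Fixpoint tformula (k r : nat) : forall t : ftree k r, formula (tvar t) :=
  match r return forall t : ftree k r, formula (tvar t) with
  | 0 => fun _ => [::]
  | r'.+1 => fun t =>
      [seq (troot t, (root_clause j).1) ::
           [seq (@lift_var k r' t (j, i) (troot _), ((root_clause j).2 i).1)
           | i <- enum 'I_k.-1]
      | j <- enum 'I_(size (root_clauses t))] ++
      flatten [seq [seq [seq (lift_var l.1, l.2) | l <- C]
                   | C <- tformula (subtree ji)]
              | ji <- enum (clause_pos t)]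
  end.

Section RandomTree.
Variable R : realType.

(* The law of T_*(r): a Poisson(k a) number of clauses at the root, in each of
   which the k signs are uniform and the k - 1 hanging trees are copies of
   T_*(r-1), everything being independent. *)
Fixpoint tree_pmf (k : nat) (a : R) (r : nat) : ftree k r -> R :=
  match r return ftree k r -> R with
  | 0 => fun _ => 1
  | r'.+1 => fun t =>
      poisson_pmf (k%:R * a) (size (root_clauses t)) *
      \prod_(c <- root_clauses t)
        (2^-1 ^+ k * \prod_(i < k.-1) tree_pmf a (c.2 i).2)
  end.

Definition tree_influence (b : \bar R) (k r : nat) (t : ftree k r) : R :=
  boundary_influence (@last_gen k r t) b (tformula t) (troot t).

Definition unique_exp_decay (k : nat) (a : R) (b : \bar R) : Prop :=
  exists A gamma : R, [/\ 0 < A, 0 < gamma &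
    forall r : nat,
      (\esum_(t in [set: ftree k r]) (tree_pmf a t * tree_influence b t)%:E
        <= (A * expR (- gamma * r%:R))%:E)%E].

(* The first r generations of a tree formula with r + 1 generations. *)
Fixpoint trunc (k r : nat) : ftree k r.+1 -> ftree k r :=
  match r return ftree k r.+1 -> ftree k r with
  | 0 => fun _ => tt
  | r'.+1 => fun t =>
      [seq (c.1, [ffun i : 'I_k.-1 => ((c.2 i).1, trunc (c.2 i).2)])
      | c : bool * {ffun 'I_k.-1 -> bool * ftree k r'.+1} <- root_clauses t]
  end.

(* T_*(oo) on (Omega, P), represented by its truncations T r to the first r
   generations, each of which has the law of T_*(r). *)
Definition random_inf_tree (k : nat) (a : R) (d : measure_display)
    (Omega : measurableType d) (P : probability Omega R)
    (T : forall r : nat, Omega -> ftree k r) : Prop :=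
  [/\ forall r w, trunc (T r.+1 w) = T r w,
      forall r t, measurable [set w | T r w = t] &
      forall r t, P [set w | T r w = t] = (tree_pmf a t)%:E].

(* The almost sure statement depends only on the law of T_*(oo), hence not on
   the realization (Omega, P, T). *)
Definition as_unique (k : nat) (a : R) (b : \bar R) : Prop :=
  forall (d : measure_display) (Omega : measurableType d)
    (P : probability Omega R) (T : forall r : nat, Omega -> ftree k r),
  random_inf_tree a P T ->
  {ae P, forall w, tree_influence b (T r w) @[r --> \oo] --> (0 : R)}.

Definition alpha_u (k : nat) : \bar R :=
  ereal_sup [set a%:E | a in [set a : R |
    0 < a /\ forall b : \bar R, (0 <= b)%E -> unique_exp_decay k a b]].

Definition alpha_u' (k : nat) : \bar R :=
  ereal_sup [set a%:E | a in [set a : R |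
    0 < a /\ forall b : \bar R, (0 <= b)%E -> as_unique k a b]].

(* u k = (2 log k / k) (1 + O(log log k / log k)) as k -> oo. *)
Definition two_log_asymptotics (u : nat -> \bar R) : Prop :=
  exists2 e : nat -> R,
    e =O_\oo (fun k : nat => ln (ln k%:R) / ln k%:R : R) &
    \forall k \near \oo, u k = (2 * ln k%:R / k%:R * (1 + e k))%:E.

End RandomTree.

(* Main.v *)
(** In the tree, the root marginal is a ratio of two products over the clauses at
    the root, so everything reduces to the log-odds recursion.

    Lower bound: a clause transmits a perturbation of the log-odds of one of its
    variables damped by the probability that all its other variables violate it,
    uniformly in the temperature.  A variable whose own clauses are all satisfied
    by the value that satisfies the parent clause is violating with probability
    at most 1/2, whatever the boundary; each variable is of this kind with
    probability [exp (- k a / 2)].  With [k a / 2 = ln k - 2 ln (ln k)] there are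
    about [ln k ^ 2] such variables in a clause, which beats the [2 k ln k]
    variables of the first generation.

    Upper bound: at zero temperature a boundary forces the root to [s] as soon as
    some clause of sign [s] has all its other variables forced to violate it, so
    the probability [x_r] of this satisfies
    [x_(r+1) = 1 - exp (- (k a / 2) x_r ^ (k - 1))], and
    [k a / 2 >= ln k + 2 ln (ln k)] keeps it above [1 - 1 / (k ln k)].  The root
    can then be forced to both values with probability at least 1/2. *)
Require Import Defs.
From mathcomp Require Import all_boot all_order all_algebra.
From mathcomp Require Import all_classical all_reals all_analysis.
From mathcomp Require Import ring lra.
Set Implicit Arguments.
Unset Strict Implicit.
Unset Printing Implicit Defensive.
Import Order.TTheory GRing.Theory Num.Theory.
Import numFieldNormedType.Exports.
Local Open Scope classical_set_scope.
Local Open Scope ring_scope.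

(** A union bound. It controls the expected loss in a clause; with all [x i] equal it is Bernoulli's
    inequality. *)
Lemma one_sub_prod_le (R : realDomainType) n (x : 'I_n -> R) : (forall i, 0 <= x i <= 1) ->
  1 - \prod_i (1 - x i) <= \sum_i x i.
Proof.
elim: n x => [|n IH] x x01; first by rewrite !big_ord0 subrr.
rewrite !big_ord_recl.
have := IH (fun i => x (lift ord0 i)) (fun i => x01 _).
have /andP[x0 x1] := x01 ord0.
have p1 : \prod_(i < n) (1 - x (lift ord0 i)) <= 1.
  by apply: prodr_ile1 => i _; have /andP[? ?] := x01 (lift ord0 i); apply/andP; split; lra.
set p := \prod_(i < n) _ in p1 *; set S := \sum_(i < n) _ => h.
have : x ord0 * p <= x ord0 by rewrite ler_piMr.
lra.
Qed.

(** Distributivity with an index type varying with the factor, as the assignments of a subtree have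
    a type depending on that subtree. *)
Lemma sum_fprod (R : comPzSemiRingType) (I : finType) (T_ : I -> finType)
    (f : forall i, T_ i -> R) :
  \sum_(g : fprod T_) \prod_i f i (g i) = \prod_i \sum_(x : T_ i) f i x.
Proof.
pose F i : {ffun T_ i -> R} := [ffun x => f i x].
transitivity (\sum_(g : fprod T_) \prod_(i in I) F i (g i)).
  by apply: eq_bigr => g _; apply: eq_bigr => i _; rewrite ffunE.
rewrite (big_fprod 1 _ F).
transitivity (\prod_i \sum_(j in tagged_with T_ i) untag 0 (F i) j).
  by rewrite bigA_distr_big_dep.
apply: eq_bigr => i _; rewrite -(big_tag (fun i => F i)).
by apply: eq_bigr => x _; rewrite ffunE.
Qed.

(** * The recursion for the partition function *)

Section Partition.
Variables (R : realType) (k : nat).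
Implicit Types (b : \bar R) (r : nat).

Definition eps b : R := 1 - fine (expeR (- b)).

(** The boundary [y0] is a function on all variables, read on the last generation, so that
    restricting it to a subtree is a mere composition. *)
Definition Zcond b r (t : ftree k r) (y0 : tvar t -> bool) (s : bool) : R :=
  \sum_(y : {ffun tvar t -> bool} |
          [forall v, last_gen v ==> (y v == y0 v)] && (y (troot t) == s))
    weight b (tformula t) y.

Definition sub_assignment r (t : ftree k r.+1) (y0 : tvar t -> bool) (ji : clause_pos t) :
  tvar (subtree ji) -> bool := fun w => y0 (lift_var w).

Definition child_sign r (t : ftree k r.+1) (ji : clause_pos t) : bool :=
  ((root_clause ji.1).2 ji.2).1.

Lemma sat_clause_map (V W : finType) (f : W -> V) (y : {ffun V -> bool})
    (C : clause W) :
  sat_clause y [seq (f l.1, l.2) | l <- C] =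
  sat_clause [ffun w => y (f w)] C.
Proof. by rewrite /sat_clause has_map; apply: eq_has => l /=; rewrite ffunE. Qed.

Lemma weight_tree b r (t : ftree k r.+1) (y : {ffun tvar t -> bool}) :
  weight b (tformula t) y =
  (\prod_(j < size (root_clauses t))
    (1 - eps b * (y (troot t) != (root_clause j).1)%:R *
       \prod_(i < k.-1) (y (lift_var (troot (subtree (j, i)))) != child_sign (j, i))%:R)) *
  \prod_(ji : clause_pos t)
    weight b (tformula (subtree ji)) [ffun w => y (lift_var w)].
Proof.
rewrite /weight /= big_cat /=; congr (_ * _).
  rewrite big_map big_enum /=; apply: eq_bigr => j _.
  rewrite /psi /sat_clause /= has_map.
  have -> : (\prod_(i < k.-1)
      (y (lift_var (troot (subtree (j, i)))) != child_sign (j, i))%:R : R) =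
      (~~ has (fun i => y (lift_var (troot (subtree (j, i)))) == child_sign (j, i))
         (enum 'I_k.-1))%:R.
    have [/hasP[i _ /= Hi]|Hn] := boolP (has _ _).
      by rewrite (bigD1 i) //= Hi /= mul0r.
    rewrite big1 // => i _; move: Hn => /hasPn /(_ i).
    by rewrite mem_enum => /(_ isT) ->.
  case: (_ == _) => /=; first by rewrite mulr0 mul0r subr0.
  rewrite mulr1 [X in if X then _ else _](_ : _ = has (fun i => y (lift_var (troot (subtree (j, i)))) == child_sign (j, i))
         (enum 'I_k.-1)) //.
  case: (has _ _) => /=; first by rewrite mulr0 subr0.
  by rewrite mulr1 /eps subKr.
rewrite big_flatten /= big_map big_enum /=; apply: eq_bigr => ji _.
rewrite big_map; apply: eq_bigr => C _.
by rewrite /psi sat_clause_map.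
Qed.

(** Given the root value, each clause factor is a sum of two terms that are products over the other
    variables of the clause. Expanding the product of these sums decouples the subtrees, which are
    summed separately before the expansion is folded back. *)
Lemma Zcond_rec b r (t : ftree k r.+1) (y0 : tvar t -> bool) s :
  Zcond b y0 s =
  \prod_(j < size (root_clauses t))
    (\prod_(i < k.-1) (\sum_s' Zcond b (sub_assignment y0 (ji := (j, i))) s')
     - eps b * (s != (root_clause j).1)%:R *
       \prod_(i < k.-1) Zcond b (sub_assignment y0 (ji := (j, i))) (~~ child_sign (j, i))).
Proof.
pose T_ (ji : clause_pos t) : finType := {ffun tvar (subtree ji) -> bool}.
pose ag (ji : clause_pos t) (y : T_ ji) :=
  [forall v, last_gen v ==> (y v == sub_assignment y0 v)].
pose h (g : fprod T_) : {ffun tvar t -> bool} :=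
  [ffun v => if v is Some (existT ji w) then g ji w else s].
pose h' (y : {ffun tvar t -> bool}) : fprod T_ :=
  [fprod ji => [ffun w => y (lift_var w)]].
have hh' g : h' (h g) = g.
  by apply/fprodP => ji; rewrite fprodE; apply/ffunP => w; rewrite !ffunE.
rewrite /Zcond (reindex_onto h h'); last first.
  move=> y /andP[_ /eqP ys]; apply/ffunP => v; rewrite ffunE.
  case: v => [[ji w]|]; last by rewrite -ys.
  by rewrite fprodE ffunE.
(* The flag [c] selects one of the two terms of a clause: [false] for the constant 1, [true] for the
   violation indicator, whose coefficient is in [co]. *)
pose f c (ji : clause_pos t) (y : T_ ji) : R :=
  (if c then (y (troot _) != child_sign ji)%:R else 1) *
  ((ag ji y)%:R * weight b (tformula (subtree ji)) y).
pose co c (j : 'I_(size (root_clauses t))) : R :=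
  if c then - (eps b * (s != (root_clause j).1)%:R) else 1.
transitivity (\sum_(g : fprod T_) \prod_j \sum_(c : bool)
   co c j * \prod_(i < k.-1) f c (j, i) (g (j, i))).
  rewrite big_mkcond /=; apply: eq_bigr => g _.
  rewrite hh' eqxx andbT.
  have -> : (h g (troot t) == s) by rewrite ffunE.
  rewrite andbT.
  have -> : [forall v, last_gen v ==> (h g v == y0 v)] = [forall ji, ag ji (g ji)].
    apply/forallP/forallP => H.
      move=> ji; apply/forallP => w.
      by have := H (lift_var w); rewrite /= ffunE.
    move=> [[ji w]|] //; rewrite ffunE.
    by have /forallP /(_ w) := H ji.
  have -> : (\prod_j \sum_(c : bool) co c j * \prod_(i < k.-1) f c (j, i) (g (j, i)))
     = (\prod_j
    (1 - eps b * (s != (root_clause j).1)%:R *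
       \prod_(i < k.-1) (g (j, i) (troot _) != child_sign (j, i))%:R)) *
      \prod_(ji : clause_pos t) f false ji (g ji).
    rewrite (eq_bigr (fun ji => f false (ji.1, ji.2) (g (ji.1, ji.2)))); last by case.
    rewrite -(pair_bigA _ (fun j i => f false (j, i) (g (j, i)))) /= -big_split /=.
    apply: eq_bigr => j _; rewrite big_bool /= /f /= !big_split /=.
    set A := \prod_(i < _) _; set B := \prod_(i < _) _; set C := \prod_(i < _) _.
    by rewrite big1_eq; ring.
  case: ifP => [/forallP H|/negbT].
    rewrite weight_tree; congr (_ * _).
      apply: eq_bigr => j _; rewrite ffunE; congr (1 - _ * _).
      by apply: eq_bigr => i _; rewrite ffunE.
    apply: eq_bigr => ji _; rewrite /f /= mul1r H mul1r; congr weight.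
    by apply/ffunP => w; rewrite !ffunE.
  rewrite negb_forall => /existsP[ji Hji].
  by rewrite [X in _ * X](bigD1 ji) //= /f (negbTE Hji) !(mul0r,mulr0).
(* The expansion is indexed by the functions choosing one term per clause. *)
under eq_bigr do rewrite bigA_distr_bigA /=.
rewrite exchange_big /=.
pose Zs c (ji : clause_pos t) := \sum_(y : T_ ji) f c ji y.
transitivity (\sum_(u : {ffun 'I_(size (root_clauses t)) -> bool})
   \prod_j (co (u j) j * \prod_(i < k.-1) Zs (u j) (j, i))).
  apply: eq_bigr => u _.
  under eq_bigr do rewrite big_split /=.
  rewrite -big_distrr /= big_split /=; congr (_ * _).
  transitivity (\sum_(g : fprod T_) \prod_(ji : clause_pos t) f (u ji.1) ji (g ji)).
    apply: eq_bigr => g _; rewrite pair_bigA /=; apply: eq_bigr; by case.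
  rewrite (sum_fprod (fun ji => f (u ji.1) ji)) pair_bigA /=; apply: eq_bigr; by case.
rewrite -(bigA_distr_bigA (fun j c => co c j * \prod_(i < k.-1) Zs c (j, i))) /=.
apply: eq_bigr => j _.
rewrite big_bool /= mul1r addrC; congr (_ + _).
  apply: eq_bigr => i _; rewrite /Zs /f.
  rewrite (partition_big (fun y : T_ (j, i) => y (troot _)) predT) //=.
  apply: eq_bigr => s' _; rewrite big_mkcond [RHS]big_mkcond /=.
  apply: eq_bigr => y _; rewrite /ag mul1r.
  by case: (_ == s'); case: [forall _, _]; rewrite ?mul1r ?mul0r.
rewrite mulNr; congr (- (_ * _)).
apply: eq_bigr => i _; rewrite /Zs /f [RHS]big_mkcond /=.
apply: eq_bigr => y _; rewrite /ag.
by case: (y _); case: (child_sign _); case: [forall _, _]; rewrite ?mul1r ?mul0r.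
Qed.

End Partition.

(** * Stability of the log-odds *)

Section Closeness.
Variable R : realType.

(** The odds of [W] and [W'] agree up to a factor [1 - d] in both directions; cross-multiplied,
    because a weight may vanish at zero temperature. *)
Definition odds_close (d : R) (W W' : bool -> R) :=
  forall s, (1 - d) * (W s * W' (~~ s)) <= W (~~ s) * W' s.

(** The difference is [W s * W' (~~ s) - W (~~ s) * W' s] over the product of the totals, and this
    numerator is at most [d] times that product in absolute value. *)
Lemma odds_close_prob (d : R) (W W' : bool -> R) (s : bool) :
  0 <= d -> (forall s, 0 <= W s) -> (forall s, 0 <= W' s) ->
  0 < \sum_s W s -> 0 < \sum_s W' s -> odds_close d W W' ->
  `|W s / (\sum_s W s) - W' s / (\sum_s W' s)| <= d.
Proof.
move=> d0 W0 W'0; rewrite !big_bool /= => tW tW' c.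
have := c true; have := c false; rewrite /=.
have := W0 true; have := W0 false; have := W'0 true; have := W'0 false.
move: tW tW'; case: s.
  set A := W true; set B := W false; set A' := W' true; set B' := W' false.
  move=> t t' h1 h2 h3 h4 h5 h6.
  have -> : A / (A + B) - A' / (A' + B') = (A * B' - B * A') / ((A + B) * (A' + B')).
    by field; lra.
  rewrite normrM (ger0_norm (x := _^-1)); last by rewrite invr_ge0 mulr_ge0 //; lra.
  rewrite ler_pdivrMr ?mulr_gt0 // ler_norml.
  have := mulr_ge0 d0 (mulr_ge0 h4 h2); have := mulr_ge0 d0 (mulr_ge0 h4 h1).
  have := mulr_ge0 d0 (mulr_ge0 h3 h2); have := mulr_ge0 d0 (mulr_ge0 h3 h1).
  move=> ? ? ? ?; apply/andP; split; lra.
set A := W true; set B := W false; set A' := W' true; set B' := W' false.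
move=> t t' h1 h2 h3 h4 h5 h6.
have -> : B / (A + B) - B' / (A' + B') = (B * A' - A * B') / ((A + B) * (A' + B')).
  by field; lra.
rewrite normrM (ger0_norm (x := _^-1)); last by rewrite invr_ge0 mulr_ge0 //; lra.
rewrite ler_pdivrMr ?mulr_gt0 // ler_norml.
have := mulr_ge0 d0 (mulr_ge0 h4 h2); have := mulr_ge0 d0 (mulr_ge0 h4 h1).
have := mulr_ge0 d0 (mulr_ge0 h3 h2); have := mulr_ge0 d0 (mulr_ge0 h3 h1).
move=> ? ? ? ?; apply/andP; split; lra.
Qed.

(* With the log-odds distance [D], the bound [1 - exp (- D)] is what [odds_close]
   measures; [S] stands for the product over the other variables of a clause,
   and [1 - q <= 1 - S q] makes the estimate uniform in the temperature. *)
Lemma odds_close_step (S n m q q' : R) :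
  0 <= S -> S <= n -> n <= 1 -> 0 <= m <= 1 -> 0 <= q <= 1 -> 0 <= q' <= 1 ->
  (1 - m) * (q' * (1 - q)) <= q * (1 - q') ->
  (1 - n * m) * (1 - S * q) <= 1 - S * q'.
Proof.
move=> S0 Sn n1 /andP[m0 m1] /andP[q0 q1] /andP[q'0 q'1] h.
have h1 : q' - q <= m * (1 - q).
  have : m * (1 - q) * q' <= m * (1 - q) by rewrite ler_piMr // mulr_ge0 // subr_ge0.
  lra.
have h2 : S * (q' - q) <= S * (m * (1 - q)) by rewrite ler_wpM2l.
have h3 : 1 - q <= 1 - S * q by rewrite lerD2l lerN2 ler_piMl // (le_trans Sn).
have h4 : S * (m * (1 - q)) <= n * m * (1 - S * q).
  rewrite mulrA; apply: ler_pM => //.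
  - exact: mulr_ge0.
  - by rewrite subr_ge0.
  - by rewrite ler_wpM2r.
lra.
Qed.

(** The [q i] are replaced by the [q' i] one at a time. Each replacement is an instance of
    [odds_close_step], the other variables contributing at most the product of their bounds
    [h j]. *)
Lemma odds_close_clause (e : R) n (m h q q' : 'I_n -> R) :
  0 <= e <= 1 -> (forall i, 0 <= m i <= 1) -> (forall i, h i <= 1) ->
  (forall i, 0 <= q i <= h i) -> (forall i, 0 <= q' i <= h i) ->
  (forall i, (1 - m i) * (q' i * (1 - q i)) <= q i * (1 - q' i)) ->
  \prod_i (1 - (\prod_(j | j != i) h j) * m i) * (1 - e * \prod_i q i)
    <= 1 - e * \prod_i q' i.
Proof.
move=> /andP[e0 e1] m01 h1 qh q'h hq.
(* Hybrid sequence: replaced below index [l], original from [l] on. *)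
pose y l (j : 'I_n) := if (j < l)%N then q' j else q j.
have yh l j : 0 <= y l j <= h j by rewrite /y; case: ifP.
have h0 j : 0 <= h j by case/andP: (qh j) => a b; exact: le_trans a b.
have q01 j : 0 <= q j <= 1 by case/andP: (qh j) => -> /le_trans ->.
have q'01 j : 0 <= q' j <= 1 by case/andP: (q'h j) => -> /le_trans ->.
have nu1 i : \prod_(j | j != i) h j <= 1.
  by apply: prodr_ile1 => j _; rewrite h0 h1.
suff H l : (l <= n)%N ->
  \prod_(i < n | (i < l)%N) (1 - (\prod_(j | j != i) h j) * m i) * (1 - e * \prod_i q i)
    <= 1 - e * \prod_i y l i.
  have yn : \prod_i y n i = \prod_i q' i by apply: eq_bigr => i _; rewrite /y ltn_ord.
  have := H n (leqnn n); rewrite yn; apply: le_trans.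
  by under [X in _ <= X * _]eq_bigl do rewrite ltn_ord.
elim: l => [|l IH] ln; first by rewrite [X in X * _ <= _]big_pred0 ?mul1r.
pose o := Ordinal ln.
rewrite (bigD1 o) //=.
under [X in _ * X * _ <= _]eq_bigl => i do rewrite -val_eqE /= ltnS andbC -ltn_neqAle.
have /IH {}IH : (l <= n)%N by exact: ltnW.
rewrite -mulrA.
have n0 : 0 <= 1 - (\prod_(j | j != o) h j) * m o.
  rewrite subr_ge0 mulr_ile1 //; first exact: prodr_ge0.
  - by case/andP: (m01 o). 
  - by case/andP: (m01 o).
apply: (le_trans (ler_wpM2l n0 IH)).
have yo l' : \prod_i y l' i = y l' o * \prod_(i | i != o) y l' i by rewrite (bigD1 o).
rewrite !yo.
have -> : y l o = q o by rewrite /y ltnn.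
have -> : y l.+1 o = q' o by rewrite /y ltnSn.
have -> : \prod_(i | i != o) y l.+1 i = \prod_(i | i != o) y l i.
  apply: eq_bigr => i; rewrite -val_eqE /= /y ltnS leq_eqVlt => /negbTE -> //.
rewrite !(mulrCA e) (mulrC (q o)) (mulrC (q' o)).
apply: odds_close_step => //.
- by rewrite mulr_ge0 // prodr_ge0 // => i _; case/andP: (yh l i).
- apply: (@le_trans _ _ (\prod_(i | i != o) y l i)).
    rewrite ler_piMl // prodr_ge0 // => i _; by case/andP: (yh l i).
  exact: ler_prod.
Qed.

End Closeness.

(** * Damping of boundary perturbations along the tree *)

Section Decay.
Variables (R : realType) (k : nat).
Implicit Types (b : \bar R) (r : nat).

(* At a pure tree the root takes the value [s] with probability at least 1/2,
   whatever the boundary. *)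
Definition pure r : ftree k r -> bool -> bool :=
  match r with
  | 0 => fun _ _ => false
  | r'.+1 => fun t s => all (fun c => c.1 == s) (root_clauses t)
  end.

(** A bound, valid for every boundary, on the probability that the literal [l] is violated. *)
Definition half_pure r (l : bool * ftree k r) : R :=
  if pure l.2 l.1 then 2^-1 else 1.

(** A bound on the odds distance between any two boundaries, equal to 1 at a boundary variable. The
    losses multiply in [1 - decay], and each child is damped by the violation bounds of the other
    children of its clause. *)
Fixpoint decay r : ftree k r -> R :=
  match r with
  | 0 => fun _ => 1
  | r'.+1 => fun t =>
      1 - \prod_(c <- root_clauses t) \prod_(i < k.-1)
            (1 - (\prod_(j < k.-1 | j != i) half_pure (c.2 j)) * decay (c.2 i).2)
  end.

Lemma half_pure01 r (l : bool * ftree k r) : 0 <= half_pure l <= 1.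
Proof. by rewrite /half_pure; case: ifP => _; apply/andP; split; lra. Qed.

Lemma decay01 r (t : ftree k r) : 0 <= decay t <= 1.
Proof.
elim: r t => [|r IH] t /=; first by rewrite ler01 lexx.
set p := \prod_(c <- _) _.
suff: 0 <= p <= 1 by move=> /andP[? ?]; apply/andP; split; lra.
have H (c : bool * {ffun 'I_k.-1 -> bool * ftree k r}) (i : 'I_k.-1) :
    0 <= 1 - (\prod_(j < k.-1 | j != i) half_pure (c.2 j)) * decay (c.2 i).2 <= 1.
  have /andP[d0 d1] := IH (c.2 i).2.
  have p0 : 0 <= \prod_(j < k.-1 | j != i) half_pure (c.2 j).
    by apply: prodr_ge0 => j _; case/andP: (half_pure01 (c.2 j)).
  have p1 : \prod_(j < k.-1 | j != i) half_pure (c.2 j) <= 1.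
    by apply: prodr_ile1 => j _; exact: half_pure01.
  by rewrite subr_ge0 mulr_ile1 //= lerBlDr lerDl mulr_ge0.
apply/andP; split.
  by apply: prodr_ge0 => c _; apply: prodr_ge0 => i _; case/andP: (H c i).
apply: prodr_ile1 => c _; apply/andP; split.
  by apply: prodr_ge0 => i _; case/andP: (H c i).
exact: prodr_ile1.
Qed.

Lemma eps01 b : (0 <= b)%E -> 0 <= eps b <= 1.
Proof.
rewrite /eps; case: b => [x| |] //=.
  rewrite lee_fin => x0; rewrite subr_ge0 lerBlDr lerDl expR_ge0 andbT.
  by rewrite expR_le1 oppr_le0.
by move=> _; rewrite subr0 ler01 lexx.
Qed.

Lemma psi_ge0 b (V : finType) (y : {ffun V -> bool}) C : 0 <= psi b y C.
Proof. by rewrite /psi; case: ifP => // _; rewrite fine_ge0 // expeR_ge0. Qed.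

Lemma weight_ge0 b (V : finType) (F : formula V) (y : {ffun V -> bool}) :
  0 <= weight b F y.
Proof. by apply: prodr_ge0 => C _; exact: psi_ge0. Qed.

Lemma Zcond_ge0 b r (t : ftree k r) (y0 : tvar t -> bool) s : 0 <= Zcond b y0 s.
Proof. by apply: sumr_ge0 => y _; exact: weight_ge0. Qed.

Definition Ztot b r (t : ftree k r) (y0 : tvar t -> bool) : R :=
  \sum_s Zcond b y0 s.

Lemma Ztot_ge0 b r (t : ftree k r) (y0 : tvar t -> bool) : 0 <= Ztot b y0.
Proof. by apply: sumr_ge0 => s _; exact: Zcond_ge0. Qed.

Lemma Zcond_le_tot b r (t : ftree k r) (y0 : tvar t -> bool) s :
  Zcond b y0 s <= Ztot b y0.
Proof.
by rewrite /Ztot (bigD1 s) //= lerDl sumr_ge0 // => s' _; exact: Zcond_ge0.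
Qed.

Definition clause_factor b r (t : ftree k r.+1) (y0 : tvar t -> bool)
    (j : 'I_(size (root_clauses t))) (s : bool) : R :=
  \prod_(i < k.-1) Ztot b (sub_assignment y0 (ji := (j, i)))
  - eps b * (s != (root_clause j).1)%:R *
    \prod_(i < k.-1) Zcond b (sub_assignment y0 (ji := (j, i))) (~~ child_sign (j, i)).

Lemma clause_factor_ge0 b r (t : ftree k r.+1) (y0 : tvar t -> bool) j s :
  (0 <= b)%E -> 0 <= clause_factor b y0 j s.
Proof.
move=> /eps01 /andP[e0 e1]; rewrite /clause_factor subr_ge0.
apply: (@le_trans _ _ (1 * \prod_(i < k.-1) Ztot b (sub_assignment y0 (ji := (j, i))))).
  apply: ler_pM.
  - by rewrite mulr_ge0.
  - by apply: prodr_ge0 => i _; exact: Zcond_ge0.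
  - by case: (_ != _); rewrite ?mulr1 ?mulr0.
  - by apply: ler_prod => i _; rewrite Zcond_ge0 Zcond_le_tot.
by rewrite mul1r.
Qed.

(** If the total of a child vanished, nonnegativity would force the factor of its clause to be 0 for
    both root values. Hence the conditional laws of the children are well defined. *)
Lemma Ztot_sub_gt0 b r (t : ftree k r.+1) (y0 : tvar t -> bool) ji :
  (0 <= b)%E -> 0 < Ztot b y0 -> 0 < Ztot b (sub_assignment y0 (ji := ji)).
Proof.
move=> b0; case: ji => j i.
rewrite lt_neqAle eq_sym => /andP[+ _].
rewrite psumr_neq0; last by move=> s _; exact: Zcond_ge0.
move=> /hasP[s _] /=; rewrite Zcond_rec => /lt0r_neq0 /prodf_neq0 /(_ j isT).
rewrite -/(Ztot b _) => fj.
rewrite lt_neqAle Ztot_ge0 andbT eq_sym; apply: contra fj => /eqP Z0.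
have [e0 _] := andP (eps01 b0).
have P0 : \prod_(i < k.-1) Ztot b (sub_assignment y0 (ji := (j, i))) = 0.
  by rewrite (bigD1 i) //= Z0 mul0r.
have := clause_factor_ge0 y0 j s b0; rewrite /clause_factor /Ztot in P0 *; rewrite P0 sub0r oppr_ge0 => h.
by rewrite oppr_eq0 eq_le h mulr_ge0 // ?mulr_ge0 // prodr_ge0 // => i' _; exact: Zcond_ge0.
Qed.

(** The value [s] satisfies every root clause, so each of its clause factors dominates that of
    [~~ s]. No tree of depth 0 is pure. *)
Lemma Zcond_pure b r (t : ftree k r) (y0 : tvar t -> bool) s :
  (0 <= b)%E -> pure t s -> Zcond b y0 (~~ s) <= Zcond b y0 s.
Proof.
case: r t y0 => [//|r] t y0 b0 /= /allP p.
rewrite !Zcond_rec; apply: ler_prod => j _; rewrite -/(clause_factor b y0 j _) clause_factor_ge0 //=.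
have /eqP -> : (root_clause j).1 == s by apply: p; exact: mem_tnth.
rewrite eqxx mulr0 mul0r subr0 gerBl !mulr_ge0 //.
  by case/andP: (eps01 b0).
by apply: prodr_ge0 => i _; exact: Zcond_ge0.
Qed.

(** Induction on the depth, clause by clause. A clause penalizes only the root value opposite to its
    sign, so it enters the odds through a single factor, to which [odds_close_clause] applies. *)
Lemma decay_odds_close b r (t : ftree k r) (y0 z0 : tvar t -> bool) :
  (0 <= b)%E -> 0 < Ztot b y0 -> 0 < Ztot b z0 ->
  odds_close (decay t) (Zcond b y0) (Zcond b z0).
Proof.
move=> b0; elim: r t y0 z0 => [|r IH] t y0 z0 ty tz s /=.
  by rewrite subrr mul0r mulr_ge0 // Zcond_ge0.
have e01 := eps01 b0.
rewrite subKr big_tnth !Zcond_rec -!big_split /=; apply: ler_prod => j _.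
rewrite -!/(Ztot b _).
pose T y i := Ztot b (sub_assignment (t := t) y (ji := (j, i))).
(* [q y i] is the conditional probability that child [i] violates the clause, [h i] its bound, and
   [m i] the odds distance given by induction. *)
pose q y i := Zcond b (sub_assignment (t := t) y (ji := (j, i))) (~~ child_sign (j, i)) / T y i.
pose h i := half_pure ((root_clause j).2 i).
pose m i := decay ((root_clause j).2 i).2.
have Ty i : 0 < T y0 i by exact: Ztot_sub_gt0.
have Tz i : 0 < T z0 i by exact: Ztot_sub_gt0.
have factorE y s' : (forall i, 0 < T y i) -> clause_factor b y j s' =
    \prod_i T y i * (1 - eps b * (s' != (root_clause j).1)%:R * \prod_i q y i).
  move=> Tp; rewrite /clause_factor mulrBr mulr1; congr (_ - _).
  rewrite mulrCA -big_split /=; congr (_ * _); apply: eq_bigr => i _.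
  by rewrite /q mulrC divfK // gt_eqF.
have qh y : (forall i, 0 < T y i) -> forall i, 0 <= q y i <= h i.
  move=> Tp i; rewrite divr_ge0 ?Zcond_ge0 //=; last exact: ltW.
  rewrite /h /half_pure; case: ifP => p; rewrite ler_pdivrMr //; last first.
    by rewrite mul1r Zcond_le_tot.
  have := Zcond_pure (sub_assignment (t := t) y (ji := (j, i))) b0 p.
  rewrite /T /Ztot big_bool /= /child_sign.
  by case: (((root_clause j).2 i).1) => /=; lra.
have q01 y : (forall i, 0 < T y i) -> forall i, 0 <= q y i <= 1.
  move=> Tp i; case/andP: (qh y Tp i) => -> /le_trans -> //.
  by case/andP: (half_pure01 ((root_clause j).2 i)).
have frac (u a1 a2 a3 a4 t1 t2 : R) : 0 < t1 -> 0 < t2 ->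
    u * (a1 * a2) <= a3 * a4 -> u * (a1 / t1 * (a2 / t2)) <= a4 / t2 * (a3 / t1).
  move=> p1 p2 le_u; have n1 := gt_eqF p1; have n2 := gt_eqF p2.
  have -> : u * (a1 / t1 * (a2 / t2)) = u * (a1 * a2) / (t1 * t2).
    by field; rewrite n1 n2.
  have -> : a4 / t2 * (a3 / t1) = (a3 * a4) / (t1 * t2) by field; rewrite n1 n2.
  by rewrite ler_pM2r // invr_gt0 mulr_gt0.
have qq y z : (forall i, 0 < T y i) -> (forall i, 0 < T z i) ->
    forall i, (1 - m i) * (q z i * (1 - q y i)) <= q y i * (1 - q z i).
  move=> Tp Tp' i.
  have := IH _ (sub_assignment (t := t) z (ji := (j, i))) (sub_assignment (t := t) y (ji := (j, i)))
     (Tp' i) (Tp i) (~~ child_sign (j, i)).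
  rewrite negbK.
  have c u : (forall i, 0 < T u i) -> 1 - q u i =
      Zcond b (sub_assignment (t := t) u (ji := (j, i))) (child_sign (j, i)) / T u i.
    move=> Tu; rewrite /q -[X in X - _](@divff _ (T u i)) ?gt_eqF // -mulrBl.
    congr (_ / _); rewrite /T /Ztot big_bool /=.
    by case: (child_sign _) => /=; ring.
  rewrite !c // /q -/(m i).
  exact: frac.
have key y z s' : (forall i, 0 < T y i) -> (forall i, 0 < T z i) ->
    \prod_i (1 - (\prod_(i' | i' != i) h i') * m i) *
      (1 - eps b * (s' != (root_clause j).1)%:R * \prod_i q y i) <=
     1 - eps b * (s' != (root_clause j).1)%:R * \prod_i q z i.
  move=> Tp Tp'; apply: odds_close_clause.
  - by case: (_ != _); rewrite ?mulr1 ?mulr0 ?lexx ?ler01.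
  - by move=> i; exact: decay01.
  - by move=> i; case/andP: (half_pure01 ((root_clause j).2 i)).
  - exact: qh.
  - exact: qh.
  - exact: qq.
rewrite -!/(clause_factor b _ j _); apply/andP; split.
  rewrite mulr_ge0 ?mulr_ge0 ?clause_factor_ge0 //; apply: prodr_ge0 => i _.
  rewrite subr_ge0 mulr_ile1 //.
  - by apply: prodr_ge0 => l _; case/andP: (half_pure01 ((tnth (in_tuple (root_clauses t)) j).2 l)).
  - by case/andP: (decay01 ((tnth (in_tuple (root_clauses t)) j).2 i).2).
  - by apply: prodr_ile1 => l _; exact: half_pure01.
  - by case/andP: (decay01 ((tnth (in_tuple (root_clauses t)) j).2 i).2).
rewrite !factorE //.
have := key y0 z0 s Ty Tz; have := key z0 y0 (~~ s) Tz Ty.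
set D := \prod_i (1 - _).
rewrite -/(root_clause j) -/D.
have P0 : 0 <= \prod_i T y0 i * \prod_i T z0 i.
  by rewrite mulr_ge0 // prodr_ge0 // => i _; exact: ltW.
move=> k1 k2.
rewrite mulrACA [X in _ <= X]mulrACA [X in X <= _]mulrCA ler_wpM2l //.
(* Exactly one of [s] and [~~ s] violates the root literal; the normalized factor of the other is 1
   for both boundaries. *)
case: (eqVneq s (root_clause j).1) k1 k2 => [->|ns] /=; rewrite ?eqxx ?mulr0 ?mul0r ?subr0 ?mulr1 ?mul1r.
  by [].
have -> : (~~ s == (root_clause j).1) by move: ns; case: (s); case: (root_clause j).1.
by rewrite /= ?mulr0 ?mul0r ?subr0 ?mulr1 ?mul1r.
Qed.

End Decay.

(** * Boundary influence and forcing *)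

Section Influence.
Variables (R : realType) (k : nat).
Implicit Types (b : \bar R) (r : nat).

Lemma Ztot_sum b r (t : ftree k r) (y0 : tvar t -> bool) :
  Ztot b y0 = \sum_(y : {ffun tvar t -> bool} | [forall v, last_gen v ==> (y v == y0 v)])
    weight b (tformula t) y.
Proof.
by rewrite [RHS](partition_big (fun y : {ffun tvar t -> bool} => y (troot t)) predT).
Qed.

Lemma weight_le_Zcond b r (t : ftree k r) (y0 : tvar t -> bool)
    (y : {ffun tvar t -> bool}) : (forall v, last_gen v -> y v = y0 v) ->
  weight b (tformula t) y <= Zcond b y0 (y (troot t)).
Proof.
move=> yy0; rewrite /Zcond (bigD1 y) /=.
  by rewrite lerDl sumr_ge0 // => ? _; exact: weight_ge0.
by rewrite eqxx andbT; apply/forallP => v; apply/implyP => /yy0 ->.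
Qed.

Lemma weight_sat b (V : finType) (F : formula V) (y : {ffun V -> bool}) :
  sat_formula y F -> weight b F y = 1.
Proof.
move=> /allP s; rewrite /weight big_seq big1 // => C CF.
by rewrite /psi s.
Qed.

Lemma weight_pinfty (V : finType) (F : formula V) (y : {ffun V -> bool}) :
  0 < weight (+oo%E : \bar R) F y -> sat_formula y F.
Proof.
move=> w0; apply/allP => C CF; move: w0; rewrite /weight => /lt0r_neq0.
rewrite prodf_seq_neq0 => /allP /(_ C CF).
by rewrite /psi; case: ifP => //= _; rewrite eqxx.
Qed.

Definition boundary_ext r (t : ftree k r) (xB : {ffun {v : tvar t | last_gen v} -> bool})
  (v : tvar t) : bool := if insub v is Some u then xB u else false.

Lemma agree_boundary_ext r (t : ftree k r) (xB : {ffun {v : tvar t | last_gen v} -> bool})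
    (y : {ffun tvar t -> bool}) :
  agree y xB = [forall v, last_gen v ==> (y v == boundary_ext xB v)].
Proof.
apply/forallP/forallP => [H v|H v].
  by apply/implyP => lv; rewrite /boundary_ext insubT; exact: (H (Sub v lv)).
by have := H (val v); rewrite (valP v) /= /boundary_ext valK.
Qed.

Lemma admissible_Ztot b r (t : ftree k r)
    (xB : {ffun {v : tvar t | last_gen v} -> bool}) :
  (0 <= b)%E -> admissible b (tformula t) xB -> 0 < Ztot b (boundary_ext xB).
Proof.
move=> b0 adm.
suff [y ay wy] : exists2 y, agree y xB & 0 < weight b (tformula t) y.
  apply: (lt_le_trans wy); apply: (le_trans _ (Zcond_le_tot _ _ (y (troot t)))).
  apply: weight_le_Zcond => v lv; move: ay; rewrite agree_boundary_ext => /forallP /(_ v).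
  by rewrite lv => /eqP.
move: b0 adm; rewrite /admissible; case: b => [x| |] //=.
  move=> x0 _; exists [ffun v => boundary_ext xB v].
    by rewrite agree_boundary_ext; apply/forallP => v; rewrite ffunE eqxx implybT.
  apply: prodr_gt0 => C _; rewrite /psi; case: ifP => //= _; exact: expR_gt0.
by move=> _ /existsP[y /andP[ay /(weight_sat +oo%E) wy]]; exists y => //; rewrite wy.
Qed.

Lemma gibbs_condE b r (t : ftree k r)
    (xB : {ffun {v : tvar t | last_gen v} -> bool}) s :
  0 < Ztot b (boundary_ext xB) ->
  gibbs_cond b (tformula t) xB (troot t) s = Zcond b (boundary_ext xB) s / Ztot b (boundary_ext xB).
Proof.
move=> tot0; rewrite /gibbs_cond /gibbs.
set Z := \sum_y weight _ _ y.
have Z0 : 0 < Z.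
  apply: (lt_le_trans tot0); rewrite Ztot_sum /Z [leRHS](bigID (fun y : {ffun tvar t -> bool} => [forall v, last_gen v ==> (y v == boundary_ext xB v)])) /=.
  by rewrite lerDl sumr_ge0 // => ? _; exact: weight_ge0.
rewrite -!mulr_suml.
have -> : \sum_(y | agree y xB && (y (troot t) == s)) weight b (tformula t) y = Zcond b (boundary_ext xB) s.
  by apply: eq_bigl => y; rewrite agree_boundary_ext.
have -> : \sum_(y | agree y xB) weight b (tformula t) y = Ztot b (boundary_ext xB).
  by rewrite Ztot_sum; apply: eq_bigl => y; rewrite agree_boundary_ext.
by field; rewrite !gt_eqF.
Qed.

(** As [decay] does not depend on [b], the estimate is uniform in the temperature. *)
Lemma tree_influence_decay b r (t : ftree k r) :
  (0 <= b)%E -> tree_influence b t <= decay R t.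
Proof.
move=> b0; have /andP[d0 d1] := decay01 R t.
apply: bigmax_le => // -[x z] /= /andP[ax az].
have tx := admissible_Ztot b0 ax; have tz := admissible_Ztot b0 az.
rewrite /tv_dist big_bool /=.
have H s : `|gibbs_cond b (tformula t) x (troot t) s -
             gibbs_cond b (tformula t) z (troot t) s| <= decay R t.
  rewrite !gibbs_condE //.
  apply: odds_close_prob => //; try (by move=> ?; exact: Zcond_ge0).
  exact: decay_odds_close.
have := H true; have := H false; lra.
Qed.

Lemma tree_influence_ge0 b r (t : ftree k r) : 0 <= tree_influence b t.
Proof. exact: bigmax_ge_id. Qed.

(* A sufficient condition for some boundary assignment to force the root to [s]
   at zero temperature. *)
Fixpoint force r : ftree k r -> bool -> bool :=
  match r with
  | 0 => fun _ _ => true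
  | r'.+1 => fun t s =>
      has (fun c : bool * {ffun 'I_k.-1 -> bool * ftree k r'} =>
        (c.1 == s) && [forall i, force (c.2 i).2 (~~ (c.2 i).1)])
        (root_clauses t)
  end.

(** Boundaries are chosen independently in the subtrees; the default [true] goes to the root, which
    is not a boundary variable. *)
Definition glue r (t : ftree k r.+1)
    (Y : forall ji : clause_pos t, tvar (subtree ji) -> bool) : tvar t -> bool :=
  fun v => if v is Some (existT ji w) then Y ji w else true.

Lemma sub_assignment_glue r (t : ftree k r.+1) Y ji : sub_assignment (@glue r t Y) (ji := ji) = Y ji.
Proof. by []. Qed.

Local Notation Zoo := (Zcond (+oo%E : \bar R)).

Lemma eps_pinfty : eps (+oo%E : \bar R) = 1.
Proof. by rewrite /eps /= subr0. Qed.

(** Each violating weight is strictly below the total of its child, hence so are the products;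
    [1 < k] provides a child [i0], needed for strictness. *)
Lemma clause_factor_gt0 r (t : ftree k r.+1) (y0 : tvar t -> bool)
    (j : 'I_(size (root_clauses t))) s : (1 < k)%N ->
  (forall i, 0 < Zoo (sub_assignment y0 (ji := (j, i))) (child_sign (j, i))) ->
  0 < clause_factor (+oo%E : \bar R) y0 j s.
Proof.
move=> k1 H; rewrite /clause_factor eps_pinfty mul1r subr_gt0.
have i0 : 'I_k.-1 by case: (k) k1 => [|[|n]] // _; exact: ord0.
have H' i : Zoo (sub_assignment y0 (ji := (j, i))) (~~ child_sign (j, i)) <
    Ztot (+oo%E : \bar R) (sub_assignment y0 (ji := (j, i))).
  rewrite /Ztot big_bool /=; have := H i.
  by case: (child_sign _) => /= ?; rewrite ?ltrDl ?ltrDr.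
case: (_ != _); rewrite ?mul1r ?mul0r; last first.
  by apply: prodr_gt0 => i _; apply: (le_lt_trans _ (H' i)); exact: Zcond_ge0.
rewrite (bigD1 i0) //= [ltRHS](bigD1 i0) //=.
have P0 : 0 < \prod_(i | i != i0) Ztot (+oo%E : \bar R) (sub_assignment y0 (ji := (j, i))).
  by apply: prodr_gt0 => i _; apply: (le_lt_trans _ (H' i)); exact: Zcond_ge0.
apply: (@le_lt_trans _ _ (Zoo (sub_assignment y0 (ji := (j, i0))) (~~ child_sign (j, i0)) *
   \prod_(i | i != i0) Ztot (+oo%E : \bar R) (sub_assignment y0 (ji := (j, i))))).
  apply: ler_wpM2l; first exact: Zcond_ge0.
  by apply: ler_prod => i _; rewrite Zcond_ge0 ltW.
by rewrite ltr_pM2r.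
Qed.

Lemma Zcond_leaf_gt0 (t : ftree k 0) s : 0 < Zoo (t := t) (fun=> s) s.
Proof.
pose y : {ffun tvar t -> bool} := [ffun=> s].
have := @weight_le_Zcond +oo%E _ t (fun=> s) y.
rewrite weight_sat // ffunE => le1Z; apply: (lt_le_trans ltr01); apply: le1Z => v _.
by rewrite ffunE.
Qed.

(** A boundary that lets every child satisfy its parent clause leaves both root values possible. *)
Lemma Zcond_gt0 r (t : ftree k r) s : (1 < k)%N -> exists y0, 0 < Zoo (t := t) y0 s.
Proof.
move=> k1; elim: r t s => [|r IH] t s.
  by exists (fun _ => s); exact: Zcond_leaf_gt0.
pose Y ji := projT1 (cid (IH (@subtree k r t ji) (child_sign ji))).
exists (glue Y); rewrite Zcond_rec; apply: prodr_gt0 => j _.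
apply: (@clause_factor_gt0 _ t (glue Y) j _ k1) => i; rewrite sub_assignment_glue.
by rewrite /Y; case: cid.
Qed.

(** The children of a witnessing clause are forced to violate it, while those of the other clauses
    are left able to satisfy theirs: the root must take the value [s], and nothing prevents it. *)
Lemma force_Zcond r (t : ftree k r) s : (1 < k)%N -> force t s ->
  exists y0, 0 < Zoo (t := t) y0 s /\ Zoo (t := t) y0 (~~ s) = 0.
Proof.
move=> k1; elim: r t s => [|r IH] t s.
  move=> _; exists (fun _ => s); split.
    exact: Zcond_leaf_gt0.
  rewrite /Zcond big_pred0 // => y; apply/negP => /andP[/forallP ys /eqP yt].
  by have := ys (troot t); rewrite yt /=; case: (s).
move=> /= /hasP[c ct /andP[/eqP cs /forallP cf]].
have [j0 cj] : exists j0, root_clause (t := t) j0 = c.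
  by have /seq_tnthP[j0 ->] := ct; exists j0.
pose v (ji : clause_pos t) : bool := if ji.1 == j0 then ~~ child_sign ji else child_sign ji.
have EY (ji : clause_pos t) : exists y0 : tvar (subtree ji) -> bool,
    0 < Zoo y0 (v ji) /\ (ji.1 = j0 -> Zoo y0 (child_sign ji) = 0).
  rewrite /v; case: (eqVneq ji.1 j0) => [e|ne].
    have /IH[y0 [y1 y2]] : force (subtree ji) (~~ child_sign ji).
      by rewrite /subtree /child_sign e cj.
    by rewrite negbK in y2; exists y0.
  have [y0 y1] := Zcond_gt0 (subtree ji) (child_sign ji) k1; exists y0; split=> // e.
  by rewrite e eqxx in ne.
pose Y ji := projT1 (cid (EY ji)).
have Y1 ji : 0 < Zoo (Y ji) (v ji) by rewrite /Y; case: cid => ? [].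
have Y2 i : Zoo (Y (j0, i)) (child_sign (j0, i)) = 0 by rewrite /Y; case: cid => ? [_ ->].
(* The whole mass of each child of [j0] sits on its violating value, so the two products cancel. *)
have f0 : clause_factor (+oo%E : \bar R) (glue Y) j0 (~~ s) = 0.
  rewrite /clause_factor eps_pinfty cj cs mul1r; have -> : (~~ s != s) by case: (s).
  rewrite mul1r; apply/eqP; rewrite subr_eq0; apply/eqP; apply: eq_bigr => i _.
  rewrite sub_assignment_glue /Ztot big_bool /=; have := Y2 i.
  by case: (child_sign _) => /= ->; rewrite ?add0r ?addr0.
exists (glue Y); rewrite !Zcond_rec; split; last first.
  by rewrite (bigD1 j0) //= [X in X * _]f0 mul0r.
apply: prodr_gt0 => j _; case: (eqVneq j j0) => [->|ne]; last first.
  apply: (@clause_factor_gt0 _ t (glue Y) j _ k1) => i; rewrite sub_assignment_glue.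
  by have := Y1 (j, i); rewrite /v /= (negbTE ne).
rewrite cj cs eqxx mulr0 mul0r subr0; apply: prodr_gt0 => i _.
rewrite sub_assignment_glue; apply: (lt_le_trans (Y1 (j0, i))); exact: Zcond_le_tot.
Qed.

Lemma force_boundary r (t : ftree k r) s : (1 < k)%N -> force t s ->
  exists2 xB : {ffun {v : tvar t | last_gen v} -> bool},
    admissible (+oo%E : \bar R) (tformula t) xB &
    gibbs_cond (+oo%E : \bar R) (tformula t) xB (troot t) =1 (fun s' => (s' == s)%:R).
Proof.
move=> k1 /(force_Zcond k1)[y0 [y1 y2]].
pose xB : {ffun {v : tvar t | last_gen v} -> bool} := [ffun u => y0 (val u)].
have ye s' : Zoo (boundary_ext xB) s' = Zoo y0 s'.
  apply: eq_bigl => y; congr (_ && _); apply: eq_forallb => v.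
  case lv : (last_gen v) => //=.
  by rewrite /boundary_ext insubT /xB ffunE.
exists xB.
  rewrite /admissible eqxx /=.
  have : Zoo y0 s != 0 by rewrite gt_eqF.
  rewrite -ye psumr_neq0; last by move=> y _; exact: weight_ge0.
  move=> /hasP[y _ /andP[/andP[ay _] /weight_pinfty sy]].
  by apply/existsP; exists y; rewrite sy agree_boundary_ext ay.
have te : Ztot (+oo%E : \bar R) (boundary_ext xB) = Zoo y0 s.
  by rewrite /Ztot big_bool /= !ye; move: y2; case: (s) => /= ->; rewrite ?add0r ?addr0.
move=> s'; rewrite gibbs_condE te // ye.
have [->|] := eqVneq s' s; first by rewrite divff // gt_eqF.
by move: y2; case: (s) (s') => -[] //= -> _; rewrite mul0r.
Qed.

(** The two forcing boundaries give opposite point masses, at distance 1. *)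
Lemma tree_influence_force r (t : ftree k r) : (1 < k)%N ->
  force t true -> force t false -> 1 <= tree_influence (+oo%E : \bar R) t.
Proof.
move=> k1 /(force_boundary k1)[x ax gx] /(force_boundary k1)[z az gz].
apply: (le_trans _ (@le_bigmax_cond _ _ _ _ (x, z) _ _ _)); last by rewrite /= ax.
rewrite /= /tv_dist big_bool /= !gx !gz /=.
rewrite subr0 sub0r normrN normr1; lra.
Qed.

End Influence.

(** * Expectations over the random tree *)

Section Esum.
Variable R : realType.

Lemma esumZl (T : choiceType) (D : set T) (c : R) (a : T -> \bar R) :
  0 <= c -> (forall x, (0 <= a x)%E) ->
  (\esum_(x in D) (c%:E * a x) = c%:E * \esum_(x in D) a x)%E.
Proof.
move=> c0 a0; rewrite /esum -ereal_supZl //; last first.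
  by apply/set0P; exists (\sum_(x \in set0) a x)%E, set0 => //; exact: fsets_set0.
congr ereal_sup; rewrite image_comp; apply: eq_imagel => A [fA AD].
by rewrite /= ge0_mule_fsumr.
Qed.

Lemma esum_pair (T U : choiceType) (a : T -> R) (b : U -> R) (A B : R)
    (D : set T) (E : set U) :
  0 <= B -> (forall x, 0 <= a x) -> (forall x, 0 <= b x) ->
  \esum_(x in D) (a x)%:E = A%:E -> \esum_(x in E) (b x)%:E = B%:E ->
  \esum_(z in D `*` E) (a z.1 * b z.2)%:E = (A * B)%:E.
Proof.
move=> B0 a0 b0 ea eb.
have -> : D `*` E = D `*`` (fun=> E) by [].
rewrite -(@esum_esum _ _ _ D (fun=> E) (fun x y => (a x * b y)%:E)); last first.
  by move=> i j _ _; rewrite lee_fin mulr_ge0.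
transitivity (\esum_(i in D) (B%:E * (a i)%:E)%E).
  apply: eq_esum => i _; under eq_esum do rewrite EFinM.
  by rewrite esumZl ?eb 1?muleC // => y; rewrite lee_fin.
by rewrite esumZl // ?ea -?EFinM 1?mulrC // => x; rewrite lee_fin.
Qed.

Lemma esum_ffun (T : choiceType) n (g : 'I_n -> T -> R) (G : 'I_n -> R) :
  (forall i x, 0 <= g i x) -> (forall i, 0 <= G i) ->
  (forall i, \esum_(x in [set: T]) (g i x)%:E = (G i)%:E) ->
  \esum_(f in [set: {ffun 'I_n -> T}]) (\prod_i g i (f i))%:E = (\prod_i G i)%:E.
Proof.
elim: n g G => [|n IH] g G g0 G0 eg.
  have f0 : {ffun 'I_0 -> T} by apply: finfun => -[].
  have -> : [set: {ffun 'I_0 -> T}] = [set f0].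
    by apply/seteqP; split => // f _ /=; apply/ffunP => -[].
  by rewrite esum_set1 !big_ord0 // lee_fin ler01.
pose e (z : T * {ffun 'I_n -> T}) : {ffun 'I_n.+1 -> T} :=
  [ffun i => if unlift ord0 i is Some j then z.2 j else z.1].
have e0 z : e z ord0 = z.1 by rewrite ffunE unlift_none.
have eS z i : e z (lift ord0 i) = z.2 i by rewrite ffunE liftK.
rewrite (reindex_esum ([set: T] `*` [set: {ffun 'I_n -> T}]) _ e); last first.
  split => //.
    move=> z z' _ _ zz'; apply: injective_projections; first by rewrite -!e0 zz'.
    by apply/ffunP => i; rewrite -!eS zz'.
  move=> f _; exists (f ord0, [ffun i => f (lift ord0 i)]) => //.
  apply/ffunP => i; case: (unliftP ord0 i) => [j ->|->]; last by rewrite e0.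
  by rewrite eS ffunE.
rewrite big_ord_recl.
have ee z : \prod_i g i (e z i) =
    g ord0 z.1 * \prod_i g (lift ord0 i) (z.2 i).
  by rewrite big_ord_recl e0; congr (_ * _); apply: eq_bigr => i _; rewrite eS.
under eq_esum do rewrite ee.
apply: (@esum_pair _ _ (g ord0) (fun f : {ffun 'I_n -> T} => \prod_i g (lift ord0 i) (f i))) => //.
- exact: prodr_ge0.
- by move=> f; exact: prodr_ge0.
- exact: (IH (fun i => g (lift ord0 i)) (fun i => G (lift ord0 i))).
Qed.

Lemma esum_seq_size (C : choiceType) (w : C -> R) (W : R) n :
  (forall c, 0 <= w c) -> 0 <= W -> \esum_(c in [set: C]) (w c)%:E = W%:E ->
  \esum_(s in [set s : seq C | size s = n]) (\prod_(c <- s) w c)%:E = (W ^+ n)%:E.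
Proof.
move=> w0 W0 ew; elim: n => [|n IH].
  have -> : [set s : seq C | size s = 0%N] = [set [::]].
    by apply/seteqP; split => [[|]|s ->].
  by rewrite esum_set1 big_nil ?expr0 // lee_fin ler01.
rewrite (reindex_esum ([set: C] `*` [set s : seq C | size s = n]) _ (fun z => z.1 :: z.2)); last first.
  split.
  - by move=> [c s] [_ /= ->].
  - by move=> [c s] [c' s'] _ _ /= [-> ->].
  - by move=> [//|c s] /= [sn]; exists (c, s).
under eq_esum do rewrite big_cons.
rewrite exprS.
apply: (@esum_pair _ _ w (fun s => \prod_(c <- s) w c)) => //.
- exact: exprn_ge0.
- by move=> s; exact: prodr_ge0.
Qed.

(** The generating function of the Poisson law: the lists of length [n] contribute [W ^+ n], and an
    exponential series remains. *)
Lemma esum_poisson_seq (C : choiceType) (mu : R) (w : C -> R) (W : R) :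
  0 < mu -> (forall c, 0 <= w c) -> 0 <= W ->
  \esum_(c in [set: C]) (w c)%:E = W%:E ->
  \esum_(s in [set: seq C]) (poisson_pmf mu (size s) * \prod_(c <- s) w c)%:E =
  (expR (mu * (W - 1)))%:E.
Proof.
move=> mu0 w0 W0 ew.
pose J n := [set s : seq C | size s = n].
have -> : [set: seq C] = \bigcup_(n in [set: nat]) J n.
  by apply/seteqP; split => // s _; exists (size s).
rewrite esum_bigcupT; last 2 first.
- by move=> i j _ _ [s [/= <- <-]].
- by move=> s; rewrite lee_fin mulr_ge0 ?poisson_pmf_ge0 // prodr_ge0.
transitivity (\esum_(n in [set: nat]) ((expR (- mu))%:E * (exp_coeff (mu * W) n)%:E)%E).
  apply: eq_esum => n _.
  transitivity (\esum_(s in J n) ((poisson_pmf mu n)%:E * (\prod_(c <- s) w c)%:E)%E).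
    by apply: eq_esum => s <-; rewrite EFinM.
  rewrite esumZl ?poisson_pmf_ge0 //; last by move=> s; rewrite lee_fin prodr_ge0.
  rewrite (esum_seq_size _ w0 W0 ew) -!EFinM /poisson_pmf mu0 /exp_coeff /=.
  by rewrite exprMn; congr EFin; ring.
have muW0 : 0 <= mu * W by rewrite mulr_ge0 // ltW.
rewrite esumZl ?expR_ge0 //; last by move=> n; rewrite lee_fin exp_coeff_ge0.
rewrite -nneseries_esumT; last by move=> n; rewrite lee_fin exp_coeff_ge0.
have -> : (\sum_(i <oo) (exp_coeff (mu * W) i)%:E)%E = (expR (mu * W))%:E.
  rewrite /expR -EFin_lim; last exact: is_cvg_series_exp_coeff.
  by apply/congr_lim/funext => n /=; rewrite /series /= -sumEFin.
by rewrite -EFinM -expRD; congr (expR _)%:E; ring.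
Qed.

Lemma esum_bool (a : bool -> R) : (forall s, 0 <= a s) ->
  \esum_(s in [set: bool]) (a s)%:E = (a true + a false)%:E.
Proof.
move=> a0; rewrite (esumID [set true]); last by move=> s _; rewrite lee_fin.
rewrite setTI setTI (_ : ~` [set true] = [set false]).
  by rewrite !esum_set1 ?lee_fin // EFinD.
by apply/seteqP; split => -[] //= nt; case: (nt erefl).
Qed.

End Esum.

(** * One-generation formulas under the law of the random tree *)

Section Expectation.
Variables (R : realType) (k : nat) (a : R).
Hypotheses (k1 : (1 < k)%N) (a0 : 0 < a).

Local Notation mu := (k%:R * a).
Local Notation clauseT r := (bool * {ffun 'I_k.-1 -> bool * ftree k r})%type.

Let mu0 : 0 < mu. Proof. by rewrite mulr_gt0 // ltr0n ltnW. Qed.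

Definition clause_pmf r (c : clauseT r) : R :=
  2^-1 ^+ k * \prod_(i < k.-1) tree_pmf a (c.2 i).2.

Lemma tree_pmf_ge0 r (t : ftree k r) : 0 <= tree_pmf a t.
Proof.
elim: r t => [|r IH] t /=; first exact: ler01.
rewrite mulr_ge0 ?poisson_pmf_ge0 // prodr_ge0 // => c _.
by rewrite mulr_ge0 ?exprn_ge0 ?invr_ge0 ?ler0n // prodr_ge0.
Qed.

Lemma clause_pmf_ge0 r (c : clauseT r) : 0 <= clause_pmf c.
Proof.
rewrite mulr_ge0 ?exprn_ge0 ?invr_ge0 ?ler0n // prodr_ge0 // => i _.
exact: tree_pmf_ge0.
Qed.

Lemma esum_literal r (h : bool * ftree k r -> R) (H : bool -> R) :
  (forall l, 0 <= h l) ->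
  (forall s, \esum_(t in [set: ftree k r]) (tree_pmf a t * h (s, t))%:E = (H s)%:E) ->
  \esum_(l in [set: bool * ftree k r]) (2^-1 * tree_pmf a l.2 * h l)%:E =
  ((H true + H false) / 2)%:E.
Proof.
move=> h0 eH.
have H0 s : 0 <= H s.
  rewrite -lee_fin -eH; apply: esum_ge0 => t _.
  by rewrite lee_fin mulr_ge0 // tree_pmf_ge0.
have -> : [set: bool * ftree k r] = [set: bool] `*`` (fun=> [set: ftree k r]).
  by apply/seteqP; split.
rewrite (eq_esum (b := fun l => (2^-1 * tree_pmf a l.2 * h (l.1, l.2))%:E)); last by move=> [].
rewrite -(@esum_esum _ _ _ [set: bool] (fun=> [set: ftree k r])
  (fun s t => (2^-1 * tree_pmf a t * h (s, t))%:E)); last first.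
  by move=> s t _ _; rewrite lee_fin !mulr_ge0 ?invr_ge0 ?tree_pmf_ge0 // ler0n.
transitivity (\esum_(s in [set: bool]) (2^-1 * H s)%:E).
  apply: eq_esum => s _; rewrite EFinM -eH -esumZl //.
  - by apply: eq_esum => t _; rewrite -EFinM mulrA.
  - by move=> t; rewrite lee_fin mulr_ge0 // tree_pmf_ge0.
rewrite esum_bool; first by congr EFin; ring.
by move=> s; rewrite mulr_ge0 // invr_ge0 ler0n.
Qed.

Lemma esum_clause r (u : bool -> R) (h : 'I_k.-1 -> bool * ftree k r -> R)
    (H : 'I_k.-1 -> R) :
  (forall s, 0 <= u s) -> (forall i l, 0 <= h i l) ->
  (forall i, \esum_(l in [set: bool * ftree k r])
     (2^-1 * tree_pmf a l.2 * h i l)%:E = (H i)%:E) ->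
  \esum_(c in [set: clauseT r]) (clause_pmf c * (u c.1 * \prod_i h i (c.2 i)))%:E =
  ((u true + u false) / 2 * \prod_i H i)%:E.
Proof.
move=> u0 h0 eH.
have pmf0 i l : 0 <= 2^-1 * tree_pmf a l.2 * h i l.
  by rewrite !mulr_ge0 ?invr_ge0 ?tree_pmf_ge0 // ler0n.
have H0 i : 0 <= H i by rewrite -lee_fin -eH esum_ge0 // => l _; rewrite lee_fin.
transitivity (\esum_(c in [set: bool] `*` [set: {ffun 'I_k.-1 -> bool * ftree k r}])
   (2^-1 * u c.1 * \prod_i (2^-1 * tree_pmf a (c.2 i).2 * h i (c.2 i)))%:E).
  have -> : [set: bool] `*` [set: {ffun 'I_k.-1 -> bool * ftree k r}] = setT.
    by apply/seteqP; split.
  apply: eq_esum => c _; congr EFin.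
  rewrite !big_split /= prodr_const card_ord /clause_pmf.
  (* Of the [k] factors 1/2, one goes to the root sign and one to each of the other [k - 1]
     signs. *)
  by rewrite -[in 2^-1 ^+ k](prednK (ltnW k1)) exprS; ring.
apply: (@esum_pair _ _ _ (fun s => 2^-1 * u s) (fun f : {ffun 'I_k.-1 -> bool * ftree k r} =>
  \prod_i (2^-1 * tree_pmf a (f i).2 * h i (f i)))).
- exact: prodr_ge0.
- by move=> s; rewrite mulr_ge0 ?invr_ge0 ?ler0n.
- by move=> f; apply: prodr_ge0.
- rewrite esum_bool; first by congr EFin; ring.
  by move=> s; rewrite mulr_ge0 ?invr_ge0 ?ler0n.
- exact: (esum_ffun (g := fun i l => 2^-1 * tree_pmf a l.2 * h i l)).
Qed.

Lemma esum_tree r (w : clauseT r -> R) (W : R) :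
  (forall c, 0 <= w c) ->
  \esum_(c in [set: clauseT r]) (clause_pmf c * w c)%:E = W%:E ->
  \esum_(t in [set: ftree k r.+1])
    (tree_pmf a t * \prod_(c <- root_clauses t) w c)%:E = (expR (mu * (W - 1)))%:E.
Proof.
move=> w0 eW.
have cw0 c : 0 <= clause_pmf c * w c by rewrite mulr_ge0 // clause_pmf_ge0.
have W0 : 0 <= W by rewrite -lee_fin -eW esum_ge0 // => c _; rewrite lee_fin.
rewrite -(esum_poisson_seq mu0 cw0 W0 eW); apply: eq_esum => t _.
by rewrite -mulrA -big_split.
Qed.

(** The total mass of the trees is a hypothesis because this is a step of the induction that proves
    it. *)
Lemma esum_clause_pmf_of r : \esum_(t in [set: ftree k r]) (tree_pmf a t)%:E = 1%E ->
  \esum_(c in [set: clauseT r]) (clause_pmf c)%:E = 1%E.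
Proof.
move=> mass.
transitivity (\esum_(c in [set: clauseT r]) (clause_pmf c * (1 * \prod_(i < k.-1) 1))%:E).
  by apply: eq_esum => c _; rewrite big1 ?mulr1.
rewrite (@esum_clause r (fun=> 1) (fun _ _ => 1) (fun=> 1)) //.
  by rewrite big1 // mulr1; congr EFin; field.
move=> i; rewrite (@esum_literal r (fun=> 1) (fun=> 1)) //; first by congr EFin; field.
by move=> s; under eq_esum do rewrite mulr1.
Qed.

Lemma esum_pmf r : \esum_(t in [set: ftree k r]) (tree_pmf a t)%:E = 1%E.
Proof.
elim: r => [|r IH].
  have -> : [set: ftree k 0] = [set (tt : ftree k 0)] by apply/seteqP; split => // -[].
  by rewrite esum_set1 // lee_fin ler01.
transitivity (\esum_(t in [set: ftree k r.+1])
    (tree_pmf a t * \prod_(c <- root_clauses t) 1)%:E).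
  by apply: eq_esum => t _; rewrite big1 ?mulr1.
rewrite (@esum_tree r (fun=> 1) 1) ?subrr ?mulr0 ?expR0 //.
by under eq_esum do rewrite mulr1; exact: esum_clause_pmf_of.
Qed.

Lemma esum_clause_pmf r : \esum_(c in [set: clauseT r]) (clause_pmf c)%:E = 1%E.
Proof. by apply: esum_clause_pmf_of; exact: esum_pmf. Qed.

(** Made real through [fine]; the sum is finite for functions with values in [0, 1], by [EtreeE]. *)
Definition Etree r (f : ftree k r -> R) : R :=
  fine (\esum_(t in [set: ftree k r]) (tree_pmf a t * f t)%:E).

Definition Eclause r (w : clauseT r -> R) : R :=
  fine (\esum_(c in [set: clauseT r]) (clause_pmf c * w c)%:E).

(** The sums for [f] and [1 - f] are nonnegative and add up to 1, so both are finite. *)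
Lemma esum01_fin (T : choiceType) (p f : T -> R) :
  (forall x, 0 <= p x) -> \esum_(x in [set: T]) (p x)%:E = 1%E ->
  (forall x, 0 <= f x <= 1) ->
  [/\ (\esum_(x in [set: T]) (p x * f x)%:E \is a fin_num)%E,
    0 <= fine (\esum_(x in [set: T]) (p x * f x)%:E),
    fine (\esum_(x in [set: T]) (p x * f x)%:E) <= 1 &
    \esum_(x in [set: T]) (p x * (1 - f x))%:E =
      (1 - fine (\esum_(x in [set: T]) (p x * f x)%:E))%:E].
Proof.
move=> p0 p1 f01.
have f0 x : 0 <= p x * f x by rewrite mulr_ge0 //; case/andP: (f01 x).
have f1 x : 0 <= p x * (1 - f x) by rewrite mulr_ge0 // subr_ge0; case/andP: (f01 x).
set S := \esum_(x in _) (p x * f x)%:E; set S' := \esum_(x in _) (p x * (1 - f x))%:E.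
have S0 : (0 <= S)%E by apply: esum_ge0 => x _; rewrite lee_fin.
have S'0 : (0 <= S')%E by apply: esum_ge0 => x _; rewrite lee_fin.
have SS' : (S + S' = 1)%E.
  rewrite /S /S' -esumD; try by move=> x _; rewrite lee_fin.
  by rewrite -p1; apply: eq_esum => x _; rewrite -EFinD; congr EFin; ring.
move: S S' S0 S'0 SS' => [s| |] [s'| |] //=; rewrite !lee_fin => s0 s'0 [ss'].
split=> //; first by rewrite -ss' lerDl.
by rewrite -ss'; congr EFin; ring.
Qed.

Lemma EtreeE r (f : ftree k r -> R) : (forall t, 0 <= f t <= 1) ->
  \esum_(t in [set: ftree k r]) (tree_pmf a t * f t)%:E = (Etree f)%:E.
Proof.
by move=> /(esum01_fin (@tree_pmf_ge0 r) (esum_pmf r))[ff _ _ _]; rewrite /Etree fineK.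
Qed.

Lemma EclauseE r (w : clauseT r -> R) : (forall c, 0 <= w c <= 1) ->
  \esum_(c in [set: clauseT r]) (clause_pmf c * w c)%:E = (Eclause w)%:E.
Proof.
by move=> /(esum01_fin (@clause_pmf_ge0 r) (esum_clause_pmf r))[ff _ _ _]; rewrite /Eclause fineK.
Qed.

Lemma Etree01 r (f : ftree k r -> R) : (forall t, 0 <= f t <= 1) -> 0 <= Etree f <= 1.
Proof.
by move=> /(esum01_fin (@tree_pmf_ge0 r) (esum_pmf r))[_ h0 h1 _]; apply/andP.
Qed.

Lemma Etree_compl r (f : ftree k r -> R) : (forall t, 0 <= f t <= 1) ->
  Etree (fun t => 1 - f t) = 1 - Etree f.
Proof.
by move=> /(esum01_fin (@tree_pmf_ge0 r) (esum_pmf r))[_ _ _ e]; rewrite /Etree e.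
Qed.

Lemma Eclause_compl r (w : clauseT r -> R) : (forall c, 0 <= w c <= 1) ->
  Eclause (fun c => 1 - w c) = 1 - Eclause w.
Proof.
by move=> /(esum01_fin (@clause_pmf_ge0 r) (esum_clause_pmf r))[_ _ _ e]; rewrite /Eclause e.
Qed.

Lemma Etree_prod r (w : clauseT r -> R) : (forall c, 0 <= w c <= 1) ->
  Etree (fun t : ftree k r.+1 => \prod_(c <- root_clauses t) w c) =
  expR (mu * (Eclause w - 1)).
Proof.
move=> w01; rewrite /Etree (@esum_tree r w (Eclause w)) //.
- by move=> c; case/andP: (w01 c).
- exact: EclauseE.
Qed.

(** The clauses of sign opposite to [s] have a Poisson number of mean [mu / 2], and purity means
    that there are none. *)
Lemma Etree_pure r s :
  Etree (fun t : ftree k r.+1 => (pure t s)%:R) = expR (- (mu / 2)).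
Proof.
have -> : (fun t : ftree k r.+1 => (pure t s)%:R : R) =
    (fun t => \prod_(c <- root_clauses t) (c.1 == s)%:R).
  apply/funext => t /=; elim: (root_clauses t) => [|c l IH]; rewrite ?big_nil ?big_cons //= -IH.
  by case: (c.1 == s); rewrite ?mul1r ?mul0r.
rewrite Etree_prod; last by move=> c; case: (_ == _); rewrite ?lexx ?ler01.
congr expR; rewrite /Eclause.
have -> : \esum_(c in [set: clauseT r]) (clause_pmf c * (c.1 == s)%:R)%:E =
    \esum_(c in [set: clauseT r]) (clause_pmf c * ((c.1 == s)%:R * \prod_(i < k.-1) 1))%:E.
  by apply: eq_esum => c _; rewrite big1 ?mulr1.
rewrite (@esum_clause r (fun s' => (s' == s)%:R) (fun _ _ => 1) (fun=> 1)) //.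
  by rewrite big1 // mulr1 /=; case: s => /=; field.
move=> i; rewrite (@esum_literal r (fun=> 1) (fun=> 1)) //; first by congr EFin; field.
by move=> s'; under eq_esum do rewrite mulr1; exact: esum_pmf.
Qed.

(** The mean of [half_pure] for trees of positive depth. *)
Definition half_prob : R := 1 - expR (- (mu / 2)) / 2.

Lemma esum_half_pure r :
  \esum_(l in [set: bool * ftree k r.+1]) (2^-1 * tree_pmf a l.2 * half_pure R l)%:E =
  half_prob%:E.
Proof.
rewrite (@esum_literal r.+1 _ (fun=> half_prob)); first by congr EFin; field.
  by move=> l; case/andP: (half_pure01 R l).
move=> s.
have pp (t : ftree k r.+1) : 0 <= ((pure t s)%:R : R) / 2 <= 1.
  by case: (pure t s) => /=; apply/andP; split; lra.
have -> : \esum_(t in [set: ftree k r.+1]) (tree_pmf a t * half_pure R (s, t))%:E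
  = \esum_(t in [set: ftree k r.+1]) (tree_pmf a t * (1 - (pure t s)%:R / 2))%:E.
  apply: eq_esum => t _; congr (_ * _)%:E; rewrite /half_pure /=; case: (all _ _) => /=; lra.
have [_ _ _ ->] := esum01_fin (@tree_pmf_ge0 r.+1) (esum_pmf r.+1) pp.
congr (1 - _)%:E.
have -> : \esum_(t in [set: ftree k r.+1]) (tree_pmf a t * ((pure t s)%:R / 2))%:E =
   ((2^-1)%:E * \esum_(t in [set: ftree k r.+1]) (tree_pmf a t * (pure t s)%:R)%:E)%E.
  rewrite -esumZl ?invr_ge0 ?ler0n //.
    by apply: eq_esum => t _; rewrite -EFinM; congr EFin; ring.
  by move=> t; rewrite lee_fin mulr_ge0 ?tree_pmf_ge0.
rewrite EtreeE; last by move=> t; case: (pure t s); rewrite ?lexx ?ler01.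
by rewrite Etree_pure /= mulrC.
Qed.

(** One-step contraction: [mu] clauses on average, [k - 1] children in each, and a factor
    [half_prob] for each of the [k - 2] siblings of a child. The children have depth at least 1,
    where [half_prob] is the right mean. *)
Lemma Etree_decay r :
  Etree (@decay R k r.+2) <=
  mu * (k.-1%:R * half_prob ^+ k.-2) * Etree (@decay R k r.+1).
Proof.
pose x (c : clauseT r.+1) (i : 'I_k.-1) : R :=
  (\prod_(j < k.-1 | j != i) half_pure R (c.2 j)) * decay R (c.2 i).2.
have x01 c i : 0 <= x c i <= 1.
  have /andP[? ?] := decay01 R (c.2 i).2.
  have p0 : 0 <= \prod_(j < k.-1 | j != i) half_pure R (c.2 j).
    by apply: prodr_ge0 => j _; case/andP: (half_pure01 R (c.2 j)).
  rewrite mulr_ge0 //= mulr_ile1 //.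
  by apply: prodr_ile1 => j _; exact: half_pure01.
pose w (c : clauseT r.+1) := \prod_i (1 - x c i).
have w01 c : 0 <= w c <= 1.
  have H i : 0 <= 1 - x c i <= 1 by have /andP[? ?] := x01 c i; apply/andP; split; lra.
  by rewrite prodr_ge0 ?prodr_ile1 // => i _; case/andP: (H i).
have p01 (t : ftree k r.+2) : 0 <= \prod_(c <- root_clauses t) w c <= 1.
  by rewrite prodr_ge0 ?prodr_ile1 // => c _; case/andP: (w01 c).
have -> : Etree (@decay R k r.+2) = 1 - expR (mu * (Eclause w - 1)).
  by rewrite -(Etree_prod w01) -Etree_compl.
(* By [expR u >= 1 + u], the Poisson number of clauses costs at most its mean. *)
apply: (@le_trans _ _ (mu * (1 - Eclause w))).
  by have := expR_ge1Dx (mu * (Eclause w - 1)); lra.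
rewrite -[leRHS]mulrA ler_pM2l // -Eclause_compl // -lee_fin -EclauseE; last first.
  by move=> c; have /andP[? ?] := w01 c; apply/andP; split; lra.
set D := Etree _.
have D01 : 0 <= D <= 1 by apply: Etree01 => t; exact: decay01.
have /andP[D0 D1] := D01.
apply: (@le_trans _ _ (\esum_(c in [set: clauseT r.+1])
    (\sum_(i < k.-1) (clause_pmf c * x c i)%:E)%E)).
  apply: le_esum => c _; rewrite sumEFin lee_fin -mulr_sumr.
  by rewrite ler_wpM2l ?clause_pmf_ge0 // one_sub_prod_le.
rewrite esum_sum; last first.
  by move=> c i _ _; rewrite lee_fin mulr_ge0 ?clause_pmf_ge0 //; case/andP: (x01 c i).
have hp0 : 0 <= half_prob.
  rewrite -lee_fin -(esum_half_pure 0) esum_ge0 // => l _; rewrite lee_fin.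
  apply: mulr_ge0; last by case/andP: (half_pure01 R l).
  by rewrite mulr_ge0 ?invr_ge0 ?tree_pmf_ge0 ?ler0n.
have ex i : \esum_(c in [set: clauseT r.+1]) (clause_pmf c * x c i)%:E =
    (half_prob ^+ k.-2 * D)%:E.
  (* The summand becomes a product over the children, so independence applies. *)
  pose h j (l : bool * ftree k r.+1) : R := if j == i then decay R l.2 else half_pure R l.
  transitivity (\esum_(c in [set: clauseT r.+1])
      (clause_pmf c * (1 * \prod_j h j (c.2 j)))%:E).
    apply: eq_esum => c _; rewrite mul1r [\prod_j _](bigD1 i) //= mulrC /x /h eqxx.
    rewrite [X in _ = (_ * (_ * X))%:E](eq_bigr (fun j => half_pure R (c.2 j))).
      by congr EFin; ring.
    by move=> j /negbTE ->.
  rewrite (@esum_clause r.+1 (fun=> 1) h (fun j => if j == i then D else half_prob)) //.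
  - rewrite (bigD1 i) //= eqxx (eq_bigr (fun=> half_prob)); last by move=> j /negbTE ->.
    rewrite prodr_const (_ : #|_| = k.-2).
      by congr EFin; field.
    by rewrite cardC1 card_ord.
  - move=> j l; rewrite /h; case: ifP => _.
      by case/andP: (decay01 R l.2).
    by case/andP: (half_pure01 R l).
  - move=> j; rewrite /h; case: ifP => _; last exact: esum_half_pure.
    rewrite (@esum_literal r.+1 (fun l => decay R l.2) (fun=> D)).
    + by congr EFin; field.
    + by move=> l; case/andP: (decay01 R l.2).
    + by move=> s; rewrite EtreeE // => t; exact: decay01.
under eq_bigr do rewrite ex.
by rewrite sumEFin sumr_const card_ord lee_fin -[leLHS]mulr_natl mulrA.
Qed.

(** The right-hand side of the second hypothesis is increasing in [x] and describes how forcing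
    probabilities pass to the next depth. A point not lowered by it stays below these probabilities,
    which start from 1. *)
Lemma Etree_force x : 0 <= x <= 1 -> x <= 1 - expR (- (mu / 2 * x ^+ k.-1)) ->
  forall r s, x <= Etree (fun t : ftree k r => (force t s)%:R).
Proof.
move=> /andP[x0 x1] hx; elim=> [|r IH] s.
  rewrite /Etree; under eq_esum do rewrite mulr1.
  by rewrite esum_pmf.
pose g (c : clauseT r) : R :=
  ((c.1 == s) && [forall i, force (c.2 i).2 (~~ (c.2 i).1)])%:R.
have b01 (b : bool) : 0 <= (b%:R : R) <= 1 by case: b; rewrite ?lexx ?ler01.
have g01 c : 0 <= g c <= 1 by exact: b01.
have g01' c : 0 <= 1 - g c <= 1 by have /andP[? ?] := g01 c; apply/andP; split; lra.
have f01 (t : ftree k r.+1) : 0 <= ((force t s)%:R : R) <= 1.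
  by case: (force t s); rewrite ?lexx ?ler01.
have eF : Etree (fun t : ftree k r.+1 => 1 - (force t s)%:R) =
    expR (mu * (Eclause (fun c => 1 - g c) - 1)).
  rewrite -Etree_prod //; congr Etree; apply/funext => t /=.
  elim: (root_clauses t) => [|c l IHl]; rewrite ?big_nil ?big_cons ?subr0 //= -IHl /g.
  by case: (X in (X || _)%:R); rewrite /= ?subrr ?mul0r ?subr0 ?mul1r.
pose u s' := Etree (fun t : ftree k r => (force t (~~ s'))%:R).
have u01 s' : 0 <= u s' <= 1.
  by apply: Etree01 => t; case: force; rewrite ?lexx ?ler01.
(* The root sign agrees with [s] with probability 1/2, and the children are forced to violate their
   literals independently. *)
have eg : Eclause g = 2^-1 * ((u true + u false) / 2) ^+ k.-1.
  rewrite /Eclause.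
  have -> : \esum_(c in [set: clauseT r]) (clause_pmf c * g c)%:E =
    \esum_(c in [set: clauseT r]) (clause_pmf c * ((c.1 == s)%:R *
       \prod_i (force (c.2 i).2 (~~ (c.2 i).1))%:R))%:E.
    apply: eq_esum => c _; congr (_ * _)%:E; rewrite /g.
    case: (_ == _); rewrite ?mul0r ?mul1r //=.
    case: forallP => [H|/existsNP[i /negP nH]].
      by rewrite big1 // => i _; rewrite H.
    by rewrite (bigD1 i) //= (negbTE nH) mul0r.
  rewrite (@esum_clause r (fun s' => (s' == s)%:R) (fun _ l => (force l.2 (~~ l.1))%:R)
    (fun=> (u true + u false) / 2)) //.
    by rewrite prodr_const card_ord /=; case: s {g g01 g01' f01 eF} => /=; field.
  move=> i; apply: esum_literal => // s'.
  by rewrite EtreeE // => t; case: force; rewrite ?lexx ?ler01.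
have -> : Etree (fun t : ftree k r.+1 => (force t s)%:R) = 1 - expR (mu * - Eclause g).
  have := Etree_compl f01; rewrite eF Eclause_compl //.
  rewrite (_ : 1 - Eclause g - 1 = - Eclause g); last by ring.
  by move=> ->; rewrite opprB addrCA subrr addr0.
apply: (le_trans hx); rewrite lerD2l lerN2 ler_expR mulrN lerN2 eg.
rewrite -mulrA ler_pM2l ?mulrA //; rewrite ler_pM2l ?invr_gt0 ?ltr0n //.
apply: lerXn2r; rewrite ?nnegrE //.
  by have /andP[? _] := u01 true; have /andP[? _] := u01 false; rewrite divr_ge0 ?addr_ge0.
by have := IH (~~ true); have := IH (~~ false); rewrite /u; lra.
Qed.

(** Inclusion-exclusion for forcing [true] and forcing [false]. *)
Lemma Etree_force_both x : 0 <= x <= 1 -> x <= 1 - expR (- (mu / 2 * x ^+ k.-1)) ->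
  forall r, 2 * x - 1 <= Etree (fun t : ftree k r => (force t true && force t false)%:R).
Proof.
move=> x01 hx r.
have h1 := Etree_force x01 hx r true; have h2 := Etree_force x01 hx r false.
suff : Etree (fun t : ftree k r => (force t true)%:R) +
   Etree (fun t : ftree k r => (force t false)%:R) <=
   1 + Etree (fun t : ftree k r => (force t true && force t false)%:R) by lra.
have b01 (b : bool) : 0 <= (b%:R : R) <= 1 by case: b; rewrite ?lexx ?ler01.
have pb (t : ftree k r) (b : bool) : (0 <= (tree_pmf a t * b%:R)%:E)%E.
  by rewrite lee_fin mulr_ge0 ?tree_pmf_ge0.
rewrite -lee_fin !EFinD -!EtreeE // -(esum_pmf r) -!esumD //; last first.
  by move=> t _; rewrite lee_fin tree_pmf_ge0.
apply: le_esum => t _; rewrite -!EFinD lee_fin.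
have := tree_pmf_ge0 t; case: (force t true); case: (force t false) => /=; lra.
Qed.

End Expectation.

(** * Almost sure convergence *)

Section AlmostSure.
Variables (R : realType) (k : nat) (a : R).
Hypotheses (k1 : (1 < k)%N) (a0 : 0 < a).
Variables (d : measure_display) (Omega : measurableType d) (P : probability Omega R).

(** The codes given by [pickle] split the event into countably many disjoint elementary events. *)
Lemma countable_preimage (X : countType) (T : Omega -> X) (p : X -> R) (S : set X) :
  (forall t, measurable [set w | T w = t]) ->
  (forall t, P [set w | T w = t] = (p t)%:E) ->
  measurable [set w | S (T w)] /\
  P [set w | S (T w)] = \esum_(t in S) (p t)%:E.
Proof.
move=> mT PT.
pose F n := [set w | S (T w) /\ pickle (T w) = n].
have FE t : S t -> F (pickle t) = [set w | T w = t].
  move=> St; apply/seteqP; split => w /=.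
    by move=> [_ e]; apply: (pcan_inj pickleK).
  by move=> wt; rewrite /F /= wt.
have F0 n : ~ (pickle @` S) n -> F n = set0.
  move=> nS; apply/seteqP; split => // w [Sw e]; case: nS; by exists (T w).
have mF n : measurable (F n).
  have [[t St <-]|nS] := pselect ((pickle @` S) n); first by rewrite FE.
  by rewrite F0.
have UF : [set w | S (T w)] = \bigcup_n F n.
  by apply/seteqP; split => [w Sw|w [n _ []]//]; exists (pickle (T w)).
have mU : measurable (\bigcup_n F n) by exact: bigcup_measurable.
rewrite UF; split=> //.
rewrite measure_semi_bigcup //; last first.
  by move=> i j _ _ [w [[_ <-] [_ <-]]].
rewrite nneseries_esumT; last by move=> n; exact: measure_ge0.
transitivity (\esum_(n in pickle @` S) P (F n)).
  rewrite [RHS]esum_mkcond; apply: eq_esum => n _; case: ifPn => //.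
  by rewrite notin_setE => /F0 ->; rewrite measure0.
rewrite esum_image; last by move=> x y _ _ /(pcan_inj pickleK).
by apply: eq_esum => t St; rewrite FE // PT.
Qed.

Variable T : forall r, Omega -> ftree k r.
Hypothesis TP : random_inf_tree a P T.

Lemma prob_tree r (S : set (ftree k r)) :
  measurable [set w | S (T r w)] /\
  P [set w | S (T r w)] = \esum_(t in S) (tree_pmf a t)%:E.
Proof. by case: TP => _ mT PT; exact: countable_preimage. Qed.

(** Markov's inequality at the thresholds [z ^+ r], then the Borel-Cantelli lemma. *)
Lemma exp_decay_ae (b : \bar R) : unique_exp_decay k a b ->
  {ae P, forall w, tree_influence b (T r w) @[r --> \oo] --> (0 : R)}.
Proof.
move=> [A [g [A0 g0 H]]].
(* Half of the decay rate: the moment bound divided by the threshold [z ^+ r] is [A * z ^+ r], still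
   summable. *)
pose z := expR (- g / 2).
have z0 : 0 < z by exact: expR_gt0.
have z1 : z < 1 by rewrite expR_lt1; lra.
have zn : `|z| < 1 by rewrite gtr0_norm.
pose S r := [set t : ftree k r | z ^+ r < tree_influence b t].
pose F r := [set w | S r (T r w)].
have mF r : measurable (F r) by case: (prob_tree (S r)).
have PF r : (P (F r) <= (geometric A z r)%:E)%E.
  have [_ ->] := prob_tree (S r).
  have zr0 : 0 < z ^+ r by exact: exprn_gt0.
  rewrite -(@lee_pmul2l _ (z ^+ r)%:E) ?lte_fin // -esumZl; last 2 first.
  - exact: ltW.
  - by move=> t; rewrite lee_fin tree_pmf_ge0.
  apply: (@le_trans _ _ (\esum_(t in [set: ftree k r]) (tree_pmf a t * tree_influence b t)%:E)).
    rewrite esum_mkcond; apply: le_esum => t _.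
    have i0 : (0 <= (tree_pmf a t * tree_influence b t)%:E)%E.
      by rewrite lee_fin mulr_ge0 ?tree_pmf_ge0 ?tree_influence_ge0.
    case: ifPn => //; rewrite inE => /ltW St.
    by rewrite -EFinM lee_fin mulrC ler_wpM2l ?tree_pmf_ge0.
  apply: (le_trans (H r)); rewrite -EFinM lee_fin /geometric /= mulrCA ler_pM2l //.
  rewrite /z -!expRM_natr -expRD ler_expR; lra.
have F0 : P (lim_sup_set F) = 0.
  apply: lim_sup_set_cvg0 => //.
  apply: (@le_lt_trans _ _ (\sum_(n <oo) (geometric A z n)%:E)%E).
    by apply: lee_nneseries => // n *; exact: PF.
  have -> : (\sum_(n <oo) (geometric A z n)%:E)%E = (limn (series (geometric A z)))%:E.
    rewrite -EFin_lim; last by apply: cvgP; exact: cvg_geometric_series.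
    by apply/congr_lim/funext => n /=; rewrite /series /= -sumEFin.
  exact: ltry.
exists (lim_sup_set F); split => //.
  by apply: bigcap_measurable => // n _; exact: bigcup_measurable.
move=> w /= nw; apply: contrapT => nF; apply: nw.
have [n Hn] : exists n, forall j, (n <= j)%N -> tree_influence b (T j w) <= z ^+ j.
  apply: contrapT => nex; apply: nF => n _; apply: contrapT => nj; apply: nex.
  exists n => j nj'; rewrite leNgt; apply/negP => h; apply: nj; by exists j.
apply: (@squeeze_cvgr _ _ _ _ (fun=> 0) (fun j => z ^+ j)).
- by exists n => // j /= nj; rewrite tree_influence_ge0 Hn.
- exact: cvg_cst.
- exact: cvg_expr.
Qed.

(** With probability at least [c], [S r] occurs for infinitely many [r], by continuity of [P] along
    the decreasing tails; there the influence does not tend to 0. *)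
Lemma not_ae_of_prob (b : \bar R) (S : forall r, set (ftree k r)) (c : R) :
  0 < c -> (forall r t, S r t -> 1 <= tree_influence b t) ->
  (forall r, (c%:E <= \esum_(t in S r) (tree_pmf a t)%:E)%E) ->
  ~ {ae P, forall w, tree_influence b (T r w) @[r --> \oo] --> (0 : R)}.
Proof.
move=> c0 S1 PS [A [mA PA0 sA]].
pose G r := [set w | S r (T r w)].
have mG r : measurable (G r) by case: (prob_tree (S r)).
have mU n : measurable (\bigcup_(j >= n) G j) by exact: bigcup_measurable.
have mL : measurable (lim_sup_set G) by apply: bigcap_measurable.
have PL : (c%:E <= P (lim_sup_set G))%E.
  have cv := lim_sup_set_cvg P G mG.
  have {}cv : P (\bigcup_(j >= n) G j) @[n --> \oo] --> P (lim_sup_set G).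
    by apply: cv; apply: (le_lt_trans (probability_le1 _ _)); rewrite ?ltry.
  rewrite -(cvg_lim _ cv) //; apply: lime_ge; first by apply/cvg_ex; exists (P (lim_sup_set G)).
  apply: nearW => n; apply: (le_trans (PS n)); have [_ <-] := prob_tree (S n).
  apply: le_measure; rewrite ?inE //; first exact: mG.
  by move=> w Sw; exists n => /=.
have : (c%:E <= P A)%E.
  apply: (le_trans PL); apply: le_measure; rewrite ?inE //.
  move=> w Lw; apply: sA => /= cvw.
  have /cvgr0_norm_lt /(_ _ ltr01) [n _ Hn] := cvw.
  have [j /= nj Sj] := Lw n I.
  have := Hn j nj; rewrite ger0_norm ?tree_influence_ge0 // ltNge.
  by rewrite (S1 _ _ Sj).
by rewrite PA0 lee_fin leNgt c0.
Qed.

End AlmostSure.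

(** * A realization of the infinite tree *)

Section Nested.
Variables (R : realType) (X : nat -> countType) (pi : forall r, X r.+1 -> X r).
Variable p : forall r, X r -> R.
Variable x0 : X 0.
Hypotheses (p_ge0 : forall r (x : X r), 0 <= p x) (px0 : p x0 = 1)
  (X0 : forall x : X 0, x = x0)
  (p_pi : forall r (x : X r),
     \esum_(x' in [set x' | pi x' = x]) (p x')%:E = (p x)%:E).

Definition child r (x : X r) (m : nat) : R :=
  if @pickle_inv (X r.+1) m is Some x' then if pi x' == x then p x' else 0 else 0.

Definition cumul r (x : X r) (n : nat) : R := \sum_(0 <= m < n) child x m.

(* The sample point [w] of [0, 1) selects [x] at level [r] when it lies in the
   interval of length [p x] starting at [left_end x]. *)
Fixpoint left_end r : X r -> R :=
  match r with
  | 0 => fun _ => 0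
  | r'.+1 => fun x => left_end (pi x) + cumul (pi x) (pickle x)
  end.

Definition selects (w : R) r (x : X r) := left_end x <= w < left_end x + p x.

Lemma child_ge0 r (x : X r) m : 0 <= child x m.
Proof. by rewrite /child; case: pickle_inv => // x'; case: ifP. Qed.

Lemma child_pickle r (x' : X r.+1) : child (pi x') (pickle x') = p x'.
Proof. by rewrite /child pickleK_inv eqxx. Qed.

Lemma series_child r (x : X r) : (\sum_(m <oo) (child x m)%:E)%E = (p x)%:E.
Proof.
rewrite nneseries_esumT; last by move=> m; rewrite lee_fin child_ge0.
rewrite -p_pi.
transitivity (\esum_(m in pickle @` [set x' : X r.+1 | pi x' = x]) (child x m)%:E).
  rewrite [RHS]esum_mkcond; apply: eq_esum => m _; case: ifPn => //.
  rewrite notin_setE => nm; rewrite /child.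
  have := @pickle_invK (X r.+1) m; case: (@pickle_inv (X r.+1) m) => //= x' e.
  by case: eqP => // px; case: nm; exists x'.
rewrite esum_image; last by move=> y y' _ _ /(pcan_inj pickleK).
by apply: eq_esum => x' <-; rewrite child_pickle.
Qed.

Lemma cumul_le r (x : X r) n : cumul x n <= p x.
Proof.
rewrite -lee_fin -series_child /cumul -sumEFin.
by apply: nneseries_lim_ge => m _; rewrite lee_fin child_ge0.
Qed.

Lemma cumul_ge0 r (x : X r) n : 0 <= cumul x n.
Proof. by apply: sumr_ge0 => m _; exact: child_ge0. Qed.

Lemma cumul_mono r (x : X r) : {homo cumul x : m n / (m <= n)%N >-> m <= n}.
Proof.
move=> m n mn; rewrite /cumul [leRHS](big_cat_nat (n := m)) //= lerDl.
by apply: sumr_ge0 => i _; exact: child_ge0.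
Qed.

(** The interval of a child lies in that of its parent, since the partial sums of the children's
    masses never exceed the parent's mass. *)
Lemma selects_pi w r (x : X r.+1) : selects w x -> selects w (pi x).
Proof.
rewrite /selects /= => /andP[l u].
have := cumul_ge0 (pi x) (pickle x); have := cumul_le (pi x) (pickle x).+1.
rewrite {1}/cumul big_nat_recr //= -/(cumul _ _) child_pickle.
move=> h1 h2; apply/andP; split; lra.
Qed.

Lemma selects01 w r (x : X r) : selects w x -> 0 <= w < 1.
Proof.
elim: r x => [|r IH] x; last by move=> /selects_pi /IH.
by rewrite /selects /= (X0 x) px0 add0r.
Qed.

Lemma selects_uniq w r (x y : X r) : selects w x -> selects w y -> x = y.
Proof.
elim: r x y => [|r IH] x y; first by rewrite (X0 x) (X0 y).
move=> sx sy; have e := IH _ _ (selects_pi sx) (selects_pi sy).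
(* Intervals of distinct siblings are disjoint: the one with the smaller code ends no later than the
   other begins. *)
have below (z z' : X r.+1) : pi z = pi z' -> selects w z -> selects w z' ->
    (pickle z <= pickle z')%N -> pickle z = pickle z'.
  move=> ez /andP[_ /= u] /andP[/= l _]; rewrite leq_eqVlt => /orP[/eqP //|lt].
  have := cumul_mono (pi z) lt.
  rewrite {1}/cumul big_nat_recr //= -/(cumul _ _) child_pickle => h.
  by move: l; rewrite -ez leNgt => /negP[]; apply: (lt_le_trans u); rewrite -addrA lerD2l.
apply: (pcan_inj pickleK); case: (leqP (pickle x) (pickle y)) => [|/ltnW] xy.
  exact: below.
by apply/esym; apply: below.
Qed.

(** The masses of the children add up to [p x], so some partial sum exceeds the offset of [w]; the
    first one to do so identifies the child. *)
Lemma selects_child w r (x : X r) : selects w x ->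
  exists2 x' : X r.+1, pi x' = x & selects w x'.
Proof.
move=> /andP[l u].
have exn : exists n, w - left_end x < cumul x n.
  apply: contrapT => /forallNP nex.
  have : ((p x)%:E <= (w - left_end x)%:E)%E.
    rewrite -series_child; apply: lime_le.
      by apply: is_cvg_nneseries => m _ _; rewrite lee_fin child_ge0.
    apply: nearW => n; rewrite sumEFin lee_fin leNgt; apply/negP; exact: nex.
  rewrite lee_fin; lra.
(* The least index is not 0, as the offset is nonnegative; its predecessor is the code of the
   child. *)
case: (ex_minnP exn) => -[|n] h hmin.
  by move: h; rewrite /cumul big_geq //; lra.
have hn : cumul x n <= w - left_end x.
  by rewrite leNgt; apply/negP => /hmin; rewrite ltnn.
move: h; rewrite /cumul big_nat_recr //= -/(cumul _ _) /child.
have := @pickle_invK (X r.+1) n; case E : (@pickle_inv (X r.+1) n) => [x'|] /=; last by lra.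
move=> en; case: eqP => [ex h|]; last by lra.
exists x' => //; rewrite /selects /= ex en; apply/andP; split; lra.
Qed.

Lemma selects_ex w r : 0 <= w < 1 -> exists x : X r, selects w x.
Proof.
move=> w01; elim: r => [|r [x sx]]; first by exists x0; rewrite /selects /= px0 add0r.
by have [x' _ sx'] := selects_child sx; exists x'.
Qed.

(** The sample space is the whole line with the uniform law on [0, 1]; the null set outside [0, 1)
    is sent to 0. *)
Definition clip (w : R) : R := if 0 <= w < 1 then w else 0.

Lemma clip01 w : 0 <= clip w < 1.
Proof. by rewrite /clip; case: ifP => // _; rewrite lexx ltr01. Qed.

Definition selected r (w : R) : X r := projT1 (cid (selects_ex r (clip01 w))).

Lemma selectedP r w : selects (clip w) (selected r w).
Proof. by rewrite /selected; case: cid. Qed.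

Lemma selected_pi r w : pi (selected r.+1 w) = selected r w.
Proof.
apply: (@selects_uniq (clip w)); last exact: selectedP.
by apply: selects_pi; exact: selectedP.
Qed.

Local Notation unif := (uniform_prob (@ltr01 R)).

Lemma uniform_prob_itv (A : set R) : measurable A -> A `<=` `[0, 1] ->
  unif A = lebesgue_measure A.
Proof.
move=> mA A01; rewrite /uniform_prob (eq_integral (fun=> 1%:E)).
  by rewrite integral_cst // mul1e.
move=> x; rewrite inE => /A01; rewrite /= in_itv /= /uniform_pdf => ->.
by rewrite subr0 invr1.
Qed.

(** The element selected by the point 0 also receives all the points moved by [clip]. *)
Lemma selectedE r (x : X r) : [set w | selected r w = x] =
  `[left_end x, left_end x + p x[%classic `|`
  (if `[< selects 0 x >] then ~` `[0, 1[%classic else set0).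
Proof.
apply/seteqP; split => w /=.
  move=> <-; have := selectedP r w; rewrite /clip.
  case: ifP => w01; first by left; rewrite in_itv.
  by move=> s0; right; rewrite asboolT //= in_itv /= w01.
move=> [|].
  rewrite in_itv /= => sw; apply: (@selects_uniq (clip w)); first exact: selectedP.
  by rewrite /clip (selects01 (x := x)).
case: asboolP => // s0 /=; rewrite in_itv /= => /negP/negbTE nw.
by apply: (@selects_uniq (clip w)); [exact: selectedP|rewrite /clip nw].
Qed.

Lemma measurable_selected r (x : X r) : measurable [set w | selected r w = x].
Proof.
rewrite selectedE; apply: measurableU => //; case: asboolP => // _.
exact: measurableC.
Qed.

Lemma unif_selected r (x : X r) : unif [set w | selected r w = x] = (p x)%:E.
Proof.
have sub01 : `[left_end x, left_end x + p x[%classic `<=` `[0, 1[%classic.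
  by move=> w; rewrite /= !in_itv /=; exact: (@selects01 w r x).
have U1 : unif `[0, 1[%classic = 1%E.
  rewrite uniform_prob_itv //; last first.
    by move=> w; rewrite /= !in_itv /= => /andP[-> /ltW].
  by rewrite lebesgue_measure_itv /= lte_fin ltr01 oppr0 adde0.
have U0 : unif (~` `[0, 1[%classic) = 0%E.
  by rewrite probability_setC // [X in (_ - X)%E]U1 subee.
pose A : set R := `[left_end x, left_end x + p x[%classic.
pose B : set R := if `[< selects 0 x >] then ~` `[0, 1[%classic else set0.
have mB : measurable B by rewrite /B; case: asboolP => // _; exact: measurableC.
have AB0 : A `&` B = set0.
  by rewrite /A /B; apply/seteqP; split => // w [/sub01 w01]; case: asboolP => // _ /(_ w01).
have UI : unif B = 0%E by rewrite /B; case: asboolP => _; [exact: U0|exact: measure0].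
rewrite selectedE -/A -/B; transitivity (unif A + unif B)%E.
  by apply: (@measureU _ _ _ unif) => //; exact: measurable_itv.
rewrite UI adde0 uniform_prob_itv; last 2 first.
- exact: measurable_itv.
- by move=> w /sub01; rewrite /= !in_itv /= => /andP[-> /ltW].
rewrite /A lebesgue_measure_itv /= lte_fin ltrDl; case: ltP => h.
  by rewrite -EFinB addrAC subrr add0r.
by congr EFin; apply/eqP; rewrite eq_le h p_ge0.
Qed.

End Nested.

(** * Consistency of the tree laws under truncation *)

Section Realization.
Variables (R : realType) (k : nat) (a : R).
Hypotheses (k1 : (1 < k)%N) (a0 : 0 < a).

Local Notation clauseT r := (bool * {ffun 'I_k.-1 -> bool * ftree k r})%type.

Lemma esum_seq_fiber (C C' : choiceType) (f : C' -> C) (w' : C' -> R) (w : C -> R) :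
  (forall c, 0 <= w' c) -> (forall c, 0 <= w c) ->
  (forall c, \esum_(c' in [set c' | f c' = c]) (w' c')%:E = (w c)%:E) ->
  forall s, \esum_(s' in [set s' | map f s' = s]) (\prod_(c' <- s') w' c')%:E =
    (\prod_(c <- s) w c)%:E.
Proof.
move=> w'0 w0 ew; elim=> [|c s IH].
  have -> : [set s' | map f s' = [::]] = [set [::]].
    by apply/seteqP; split => [[|]|s ->].
  by rewrite esum_set1 !big_nil // lee_fin ler01.
rewrite (reindex_esum ([set c' | f c' = c] `*` [set s' | map f s' = s]) _
  (fun z => z.1 :: z.2)); last first.
  split.
  - by move=> [x y] [/= -> ->].
  - by move=> [x y] [x' y'] _ _ /= [-> ->].
  - by move=> [//|x y] /= [fx fy]; exists (x, y).
under eq_esum do rewrite big_cons.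
rewrite big_cons.
apply: (@esum_pair _ _ _ w' (fun s => \prod_(c <- s) w' c)) => //.
- exact: prodr_ge0.
- by move=> s'; exact: prodr_ge0.
Qed.

Definition trunc_clause r (c : clauseT r.+1) : clauseT r :=
  (c.1, [ffun i : 'I_k.-1 => ((c.2 i).1, trunc (c.2 i).2)]).

(** Truncation keeps the number of clauses and acts on each child separately, so the fibre of [t] is
    a product and its mass factors, by induction on the depth. *)
Lemma esum_trunc r (t : ftree k r) :
  \esum_(t' in [set t' : ftree k r.+1 | trunc t' = t]) (tree_pmf a t')%:E =
  (tree_pmf a t)%:E.
Proof.
elim: r t => [|r IH] t.
  have -> : [set t' : ftree k 1 | trunc t' = t] = setT.
    by apply/seteqP; split => // t' _ /=; case: t.
  exact: esum_pmf.
have ec (c : clauseT r) :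
    \esum_(c' in [set c' : clauseT r.+1 | trunc_clause c' = c]) (clause_pmf a c')%:E =
    (clause_pmf a c)%:E.
  rewrite esum_mkcond.
  pose h (i : 'I_k.-1) (l : bool * ftree k r.+1) : R :=
    ((l.1 == (c.2 i).1) && (trunc l.2 == (c.2 i).2))%:R.
  transitivity (\esum_(c' in [set: clauseT r.+1])
      (clause_pmf a c' * ((c'.1 == c.1)%:R * \prod_i h i (c'.2 i)))%:E).
    apply: eq_esum => c' _; case: ifPn; rewrite ?inE ?notin_setE /= => cc.
      rewrite -cc /= eqxx mul1r big1 ?mulr1 // => i _.
      by rewrite /h -cc /= ffunE !eqxx.
    have [e1|] := eqVneq c'.1 c.1; last by rewrite mul0r mulr0.
    have [H|/forallPn[i nh]] := boolP [forall i, ((c'.2 i).1 == (c.2 i).1) &&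
        (trunc (c'.2 i).2 == (c.2 i).2)]; last first.
      by rewrite (bigD1 i) //= /h (negbTE nh) mul0r !mulr0.
    case: cc; rewrite /trunc_clause e1; case: (c) H => c1 c2 /= /forallP H.
    congr (_, _); apply/ffunP => i; rewrite ffunE.
    have /andP[/eqP -> /eqP ->] := H i; by case: (c2 i).
  rewrite (@esum_clause _ _ _ k1 r.+1 (fun s => (s == c.1)%:R) h
    (fun i => tree_pmf a (c.2 i).2 / 2)) //.
  - rewrite /clause_pmf big_split /= prodr_const card_ord -[in 2^-1 ^+ k](prednK (ltnW k1)) exprS.
    by congr EFin; case: (c.1) => /=; field.
  move=> i.
  rewrite (@esum_literal _ _ _ r.+1 (h i)
    (fun s => (s == (c.2 i).1)%:R * tree_pmf a (c.2 i).2)) //.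
    by congr EFin; case: ((c.2 i).1) => /=; field.
  move=> s; rewrite /h /=; case: (s == _) => /=; last first.
    by rewrite mul0r esum1 // => t' _; rewrite mulr0.
  rewrite mul1r -IH [RHS]esum_mkcond; apply: eq_esum => t' _.
  case: ifPn; rewrite ?inE ?notin_setE /=; first by move=> ->; rewrite eqxx mulr1.
  by move=> /eqP /negbTE ->; rewrite mulr0.
have size_eq (t' : ftree k r.+2) : trunc t' = t ->
    size (root_clauses t') = size (root_clauses t).
  by move=> <-; rewrite /= size_map.
transitivity (\esum_(t' in [set s' | map (@trunc_clause r) s' = root_clauses t])
   ((poisson_pmf (k%:R * a) (size (root_clauses t)))%:E *
    (\prod_(c' <- t') clause_pmf a c')%:E)%E).
  by apply: eq_esum => t' /size_eq e; rewrite -EFinM -e.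
rewrite esumZl ?poisson_pmf_ge0 //; last first.
  by move=> s; rewrite lee_fin prodr_ge0 // => c _; exact: clause_pmf_ge0.
rewrite (esum_seq_fiber _ _ ec) //; by move=> c; exact: clause_pmf_ge0.
Qed.

Definition inf_tree (r : nat) (w : R) : ftree k r :=
  @selected R (ftree k) (@trunc k) (@tree_pmf R k a) (tt : ftree k 0)
    (@tree_pmf_ge0 R k a) erefl esum_trunc r w.

Lemma random_inf_tree_exists :
  @random_inf_tree R k a _ _ (uniform_prob (@ltr01 R)) inf_tree.
Proof.
have X0 (x : ftree k 0) : x = (tt : ftree k 0) by case: x.
split.
- by move=> r w; exact: selected_pi.
- by move=> r t; exact: measurable_selected.
- by move=> r t; exact: unif_selected.
Qed.

End Realization.

(** * Thresholds *)

Section Threshold.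
Variables (R : realType) (k : nat).
Hypothesis k1 : (1 < k)%N.

(** Each generation from depth 1 on gains a factor 1/e; the constant [expR 1] makes the bound
    trivial at depths 0 and 1. *)
Lemma contraction_exp_decay (a : R) (b : \bar R) : 0 < a -> (0 <= b)%E ->
  k%:R * a * (k.-1%:R * half_prob k a ^+ k.-2) <= expR (-1) ->
  unique_exp_decay k a b.
Proof.
move=> a0 b0 H; exists (expR 1), 1; split; rewrite ?expR_gt0 //.
have D01 r : 0 <= Etree a (@decay R k r) <= 1.
  by apply: Etree01 => // t; exact: decay01.
have D r : Etree a (@decay R k r) <= expR 1 * expR (- 1 * r%:R).
  rewrite -expRD; case: r => [|r].
    have /andP[_ /le_trans] := D01 0%N; apply.
    by rewrite mulr0 addr0 -[leLHS]expR0 ler_expR.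
  elim: r => [|r IH].
    have /andP[_ /le_trans] := D01 1%N; apply.
    by rewrite mulr1 subrr expR0.
  apply: (le_trans (Etree_decay k1 a0 r)).
  rewrite (_ : 1 + -1 * r.+2%:R = -1 + (1 + -1 * r.+1%:R)); last first.
    by rewrite -[in LHS]addn1 natrD; ring.
  rewrite expRD; apply: ler_pM => //; last by case/andP: (D01 r.+1).
  have hp : 0 <= half_prob k a.
    rewrite /half_prob; have : expR (- (k%:R * a / 2)) <= 1.
      by rewrite expR_le1 oppr_le0 divr_ge0 // mulr_ge0 // ltW.
    lra.
  by rewrite !mulr_ge0 // ?exprn_ge0 // ltW.
move=> r; apply: (@le_trans _ _ (\esum_(t in [set: ftree k r]) (tree_pmf a t * decay R t)%:E)).
  apply: le_esum => t _; rewrite lee_fin ler_wpM2l ?tree_pmf_ge0 //.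
  exact: tree_influence_decay.
rewrite EtreeE ?lee_fin //; exact: decay01.
Qed.

Lemma exp_decay_as_unique (a : R) (b : \bar R) : 0 < a ->
  unique_exp_decay k a b -> as_unique k a b.
Proof. by move=> a0 H d Omega P T TP; exact: (exp_decay_ae TP H). Qed.

(** With [x >= 3 / 4], the lower bound [2 * x - 1] on the probability of forcing both values is at
    least 1/2 at every depth. *)
Lemma force_not_as_unique (a x : R) : 0 < a -> 3 / 4 <= x <= 1 ->
  x <= 1 - expR (- (k%:R * a / 2 * x ^+ k.-1)) -> ~ as_unique k a +oo.
Proof.
move=> a0 /andP[x34 x1] hx /(_ _ _ _ _ (random_inf_tree_exists k1 a0)).
pose S r := [set t : ftree k r | force t true && force t false].
apply: (@not_ae_of_prob R k a _ _ _ _ (random_inf_tree_exists k1 a0) _ S (1 / 2)).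
- by rewrite divr_gt0 ?ltr0n.
- by move=> r t /andP[ft ff]; exact: tree_influence_force.
move=> r.
have x01 : 0 <= x <= 1 by rewrite x1 andbT; lra.
apply: (@le_trans _ _ (\esum_(t in [set: ftree k r])
    (tree_pmf a t * (force t true && force t false)%:R)%:E)).
  rewrite EtreeE //; last by move=> t; case: (force t true && _); rewrite ?lexx ?ler01.
  by rewrite lee_fin; apply: le_trans (Etree_force_both k1 a0 x01 hx r); lra.
rewrite [leRHS]esum_mkcond; apply: le_esum => t _.
case: ifPn; rewrite ?inE ?notin_setE /S /=; first by move=> ->; rewrite mulr1.
by move=> /negP/negbTE ->; rewrite mulr0.
Qed.

End Threshold.

(** * Explicit bounds on the thresholds for large k *)

Section Asymptotics.
Variables (R : realType) (k : nat).

Local Notation L := (ln (k%:R : R)).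
Local Notation l := (ln L).

Hypotheses (k2 : (3 < k)%N) (l13 : 13 <= l).

Let k1 : (1 < k)%N. Proof. exact: leq_trans k2. Qed.
Let k0 : 0 < k%:R :> R. Proof. by rewrite ltr0n (leq_trans _ k2). Qed.

Let L0 : 0 < L.
Proof. by apply: ln_gt0; rewrite ltr1n. Qed.

Let expl : expR l = L. Proof. by rewrite lnK. Qed.
Let expL : expR L = k%:R. Proof. by rewrite lnK. Qed.

(** As [L = expR l], the quadratic term of the series gives [L >= l ^+ 2 / 2 >= 13 / 2 * l]. *)
Let l2 : 6 * l <= L.
Proof.
have l0 : 0 <= l by apply: le_trans l13.
have := expR_ge1Dxn 1 l0; rewrite expl (_ : 2`! = 2%N) // expr2.
have hL0 := L0; have h13 := l13; have : 13 * l <= l * l by rewrite ler_wpM2r.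
lra.
Qed.

Lemma lower_threshold (b : \bar R) : (0 <= b)%E ->
  unique_exp_decay k (2 / k%:R * (L - 2 * l)) b.
Proof.
move=> b0; have h2 := l2; have hL0 := L0; have h13 := l13; set a := 2 / _ * _.
have ka : k%:R * a = 2 * (L - 2 * l) by rewrite /a; field; rewrite gt_eqF.
have a0 : 0 < a by rewrite /a mulr_gt0 ?divr_gt0 //; lra.
apply: contraction_exp_decay => //.
(* The correction [- 2 * l] raises the probability of being pure from [1 / k] to [L ^+ 2 / k]. *)
have eh : expR (- (k%:R * a / 2)) = L ^+ 2 / k%:R.
  rewrite ka (_ : - (2 * (L - 2 * l) / 2) = l + l - L); last by field.
  by rewrite expRB expRD expl expL expr2.
have hp0 : 0 <= half_prob k a.
  rewrite /half_prob; have : expR (- (k%:R * a / 2)) <= 1.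
    rewrite expR_le1 ka; lra.
  lra.
have hp : half_prob k a <= expR (- (L ^+ 2 / (2 * k%:R))).
  apply: (le_trans _ (expR_ge1Dx _)); rewrite /half_prob eh lerD2l lerN2.
  by rewrite invfM mulrA [leLHS]mulrAC.
(* As [k >= 4], the exponent [k - 2] is at least [k / 2]. *)
have hpn : half_prob k a ^+ k.-2 <= expR (- (L ^+ 2 / 4)).
  apply: (@le_trans _ _ (expR (- (L ^+ 2 / (2 * k%:R))) ^+ k.-2)).
    by apply: lerXn2r; rewrite ?nnegrE ?expR_ge0.
  rewrite -expRM_natr ler_expR mulNr lerN2.
  have kk : k%:R = k.-2%:R + 2 :> R.
    by rewrite -natrD; congr _%:R; case: (k) k2 => [|[|n]] // _; rewrite addn2.
  have k22 : 2 <= k.-2%:R :> R by rewrite ler_nat; case: (k) k2 => [|[|[|[]]]].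
  rewrite [leRHS]mulrAC -[leRHS]mulrA ler_wpM2l ?sqr_ge0 //.
  by rewrite ler_pdivlMr ?mulr_gt0 // kk; lra.
(* Crude bounds on [mu] and [k - 1] suffice: the total exponent [3 * L - L ^+ 2 / 4] is below -1
   once [L >= 14]. *)
apply: (@le_trans _ _ (expR (2 * L) * (expR L * expR (- (L ^+ 2 / 4))))).
  apply: ler_pM => //.
  - by rewrite mulr_ge0 // ltW.
  - by rewrite mulr_ge0 // exprn_ge0.
  - rewrite ka; apply: (le_trans _ (expR_ge1Dx _)); lra.
  - apply: ler_pM => //; first exact: exprn_ge0.
    by rewrite expL ler_nat leq_pred.
rewrite -!expRD ler_expR expr2.
have : 14 * L <= L * L by rewrite ler_wpM2r ?(ltW L0) //; lra.
lra.
Qed.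

Lemma upper_threshold (a : R) : 2 / k%:R * (L + 2 * l) <= a -> ~ as_unique k a +oo.
Proof.
move=> ha; have h2 := l2; have hL0 := L0; have h13 := l13.
have a0 : 0 < a by apply: lt_le_trans ha; rewrite mulr_gt0 ?divr_gt0 //; lra.
have ka : L + 2 * l <= k%:R * a / 2.
  have : k%:R * (2 / k%:R * (L + 2 * l)) <= k%:R * a by rewrite ler_wpM2l // ltW.
  by rewrite mulrA mulrCA divff ?gt_eqF // mulr1; lra.
(* For [x = 1 - y], the quantity [mu / 2 * x ^+ k.-1] has to reach [- ln y = L + l]. *)
pose y := (k%:R * L)^-1.
have kL0 : 0 < k%:R * L by rewrite mulr_gt0.
have y0 : 0 < y by rewrite invr_gt0.
have y4 : y <= 1 / 4.
  rewrite /y div1r lef_pV2 ?posrE //.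
  have : 4 * 1 <= k%:R * L by apply: ler_pM => //; [rewrite ler_nat|lra].
  lra.
apply: (@force_not_as_unique R k k1 a (1 - y)) => //; first by apply/andP; split; lra.
rewrite lerD2l lerN2.
have -> : y = expR (- (L + l)) by rewrite expRN expRD expL expl.
rewrite ler_expR lerN2 [X in 1 - X](_ : _ = y); last by rewrite expRN expRD expL expl.
have hL : 0 < L^-1 by rewrite invr_gt0.
(* Bernoulli's inequality, with [k * y = L^-1]. *)
have xk : 1 - L^-1 <= (1 - y) ^+ k.-1.
  have y01 : 0 <= y <= 1 by apply/andP; split; lra.
  have := @one_sub_prod_le R k.-1 (fun=> y) (fun=> y01).
  rewrite prodr_const sumr_const card_ord -[y *+ _]mulr_natl.
  have : k.-1%:R * y <= L^-1.
    apply: (@le_trans _ _ (k%:R * y)); first by rewrite ler_wpM2r ?(ltW y0) // ler_nat leq_pred.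
    by rewrite /y invfM mulrA divff ?gt_eqF // mul1r.
  lra.
have L1 : L^-1 <= 1 / 6.
  by rewrite div1r lef_pV2 ?posrE //; lra.
(* The loss [1 + 2 * l / L] is at most [l], so [L + l] is still reached. *)
apply: (@le_trans _ _ ((L + 2 * l) * (1 - L^-1))); last first.
  by apply: ler_pM => //; lra.
have LL : L * L^-1 = 1 by rewrite divff // gt_eqF.
have : l * L^-1 <= l * (1 / 6) by rewrite ler_wpM2l //; lra.
have -> : (L + 2 * l) * (1 - L^-1) = L + 2 * l - L * L^-1 - 2 * (l * L^-1) by ring.
rewrite LL; lra.
Qed.

Lemma alpha_u_ge : ((2 / k%:R * (L - 2 * l))%:E <= alpha_u R k)%E.
Proof.
apply: ereal_sup_ubound; exists (2 / k%:R * (L - 2 * l)) => //; split.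
  by have h2 := l2; have hL0 := L0; rewrite mulr_gt0 ?divr_gt0 //; lra.
exact: lower_threshold.
Qed.

Lemma alpha_u'_le : (alpha_u' R k <= (2 / k%:R * (L + 2 * l))%:E)%E.
Proof.
apply: ge_ereal_sup => _ [a [a0 H] <-]; rewrite lee_fin leNgt; apply/negP => /ltW ha.
by apply: (upper_threshold ha); apply: H.
Qed.

(** Together with the lower bound on [alpha_u] and the upper bound on [alpha_u'], this encloses both
    thresholds. *)
Lemma alpha_u_le_u' : (alpha_u R k <= alpha_u' R k)%E.
Proof.
apply: ge_ereal_sup => _ [a [a0 H] <-]; apply: ereal_sup_ubound; exists a => //.
by split => // b b0; apply: exp_decay_as_unique => //; exact: H.
Qed.

End Asymptotics.

Lemma two_log_asymptotics_of_bounds (R : realType) (u : nat -> \bar R) :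
  (forall k : nat, (3 < k)%N -> 13 <= ln (ln (k%:R : R)) ->
    ((2 / k%:R * (ln k%:R - 2 * ln (ln k%:R)))%:E <= u k)%E /\
    (u k <= (2 / k%:R * (ln k%:R + 2 * ln (ln k%:R)))%:E)%E) ->
  two_log_asymptotics u.
Proof.
move=> H.
have near_k : \forall k \near \oo, (3 < k)%N /\ 13 <= ln (ln (k%:R : R)).
  near=> k; split; first by near: k; exact: nbhs_infty_gt.
  have kb : expR (expR 13) <= k%:R :> R by near: k; exact: nbhs_infty_ger.
  have lb : expR 13 <= ln (k%:R : R).
    by rewrite -ler_expR lnK // posrE (lt_le_trans _ kb) ?expR_gt0.
  by rewrite -ler_expR lnK // posrE (lt_le_trans _ lb) ?expR_gt0.
(* The relative error, obtained by solving the formula for [e k]; the bounds on [u k] keep it within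
   [2 * ln (ln k) / ln k]. *)
exists (fun k => fine (u k) * k%:R / (2 * ln k%:R) - 1).
  apply/eqO_exP; exists 2; first by [].
  near=> k.
  have [k3 l13] : (3 < k)%N /\ 13 <= ln (ln (k%:R : R)) by near: k.
  have [] := H k k3 l13; set L := ln k%:R in l13 *; set l := ln L in l13 *.
  have L0 : 0 < L by apply: ln_gt0; rewrite ltr1n (leq_trans _ k3).
  have k0 : 0 < k%:R :> R by rewrite ltr0n (leq_trans _ k3).
  case: (u k) => [v| |] //=; rewrite !lee_fin => lo up.
  have -> : `|l / L| = l / L by rewrite ger0_norm // divr_ge0 ?(ltW L0) //; lra.
  rewrite (_ : _ - 1 = (v * k%:R / 2 - L) / L); last by field; rewrite gt_eqF.
  have Lv0 : 0 < L^-1 by rewrite invr_gt0.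
  rewrite normrM (gtr0_norm Lv0) mulrA ler_pM2r //.
  have e (z : R) : 2 / k%:R * z * k%:R = 2 * z by field; rewrite gt_eqF.
  have {}lo : 2 * (L - 2 * l) <= v * k%:R by rewrite -e ler_pM2r.
  have {}up : v * k%:R <= 2 * (L + 2 * l) by rewrite -e ler_pM2r.
  by rewrite ler_norml; apply/andP; split; lra.
near=> k.
have [k3 l13] : (3 < k)%N /\ 13 <= ln (ln (k%:R : R)) by near: k.
have [] := H k k3 l13.
have L0 : 0 < ln k%:R :> R by apply: ln_gt0; rewrite ltr1n (leq_trans _ k3).
have k0 : 0 < k%:R :> R by rewrite ltr0n (leq_trans _ k3).
(* The two bounds exclude infinite values, so [fine] loses nothing. *)
case: (u k) => [v| |] //= _ _; congr EFin.
by field; rewrite !gt_eqF.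
Unshelve. all: by end_near.
Qed.

Theorem theorem2 (R : realType) :
  two_log_asymptotics (@alpha_u R) /\ two_log_asymptotics (@alpha_u' R).
Proof.
split; apply: two_log_asymptotics_of_bounds => k k3 l13; split.
- exact: alpha_u_ge.
- by apply: (le_trans (alpha_u_le_u' R k)); exact: alpha_u'_le.
- by apply: (le_trans (alpha_u_ge k3 l13)); exact: alpha_u_le_u'.
- exact: alpha_u'_le.
Qed.
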